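(* Let $n\ge 2$ and let $(M,0)$ be a formal submanifold of $\mathbb{C}^{n+1}$ defined by an equation of the form $w=|z|^2+E(z,\bar z)$ with $E=O(|z|^3)$. Then the following statements are equivalent: (I) $(M,0)$ can be (formally) flattened. (II) $(M,0)$ has a flat pseudo-normal form; namely, $M$ has a pseudo-normal form given by an equation $w'=|z'|^2+\varphi(z',\overline{z'})$ with $\varphi$ satisfying the normalizations of a pseudo-normal form and the reality condition $\varphi(z',\overline{z'})=\overline{\varphi(z',\overline{z'})}$. (III) Any pseudo-normal form of $(M,0)$ is flat.
   Context: Coordinates of $\mathbb{C}^{n+1}$ are $(z,w)=(z_1,\dots,z_n,w)$, $|z|^2=\sum|z_i|^2$. $E$ is a (complex) formal power series in $(z,\bar z)$; $E=O(|z|^3)$ means all its terms have total degree $\ge 3$. A formal change of coordinates is a formal power series map $(z',w')=H(z,w)$ with $H(0)=0$ and invertible linear part; two formal submanifolds are formally equivalent if some formal change of coordinates transforms one to the other (at the level of formal defining equations). $(M,0)$ can be formally flattened if there is a formal change of coordinates $(z',w')=H(z,w)$, $H(0)=0$, such that in the new coordinates $(M,0)$ is defined by $w'=E^*(z',\overline{z'})$ with $E^*$ a formal power series satisfying $E^*(z',\overline{z'})=\overline{E^*(z',\overline{z'})}$. Set $u=\sum_{i=1}^n|z_i|^2$ and $v_k=\sum_{i=1}^{k-1}|z_i|^2-|z_k|^2$ for $2\le k\le n$. Every formal power series $\varphi(z,\bar z)$ without constant term has a unique expansion $\varphi=\sum \varphi_{(I,J)}^{(K)}z^I\bar z^Ju^{k_1}v_2^{k_2}\cdots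 v_n^{k_n}$ over multi-indices $I=(i_1,\dots,i_n)$, $J=(j_1,\dots,j_n)$, $K=(k_1,\dots,k_n)$ of nonnegative integers with $i_lj_l=0$ for all $l$; $e_j\in\mathbb{Z}^n$ is the $j$-th unit vector and $|I|=\sum i_l$. A pseudo-normal form of $(M,0)$ is a formal submanifold $(M^*,0)$ formally equivalent to $(M,0)$ and defined by $w=|z|^2+\varphi(z,\bar z)$, where $\varphi=O(|z|^3)$ satisfies, for all $k\ge 0$, $l\ge 1$, $\tau\ge 2$: $\varphi_{(0,0)}^{(\tau e_1)}=0$; $\mathrm{Re}(\varphi_{(0,0)}^{(le_1+e_i)})=0$ for $2\le i\le n$; $\varphi_{(e_i,e_j)}^{(le_1)}=0$ for $i>j$; $\varphi_{(I,0)}^{(le_1)}=\varphi_{(0,I)}^{(le_1)}=\varphi_{(0,I)}^{(ke_1+e_j)}=0$ for $|I|\ge 1$, $2\le j\le n$; $\varphi_{(I,e_h)}^{(ke_1)}=0$ for $h\ge 1$, $|I|\ge 2$, $i_h=0$; $\varphi_{(0,I)}^{(0)}=\overline{\varphi_{(I,0)}^{(0)}}$ for $|I|>2$. (Pseudo-normal forms of $(M,0)$ are not unique.) A pseudo-normal form is flat if its $\varphi$ is formally real-valued, i.e. $\varphi(z,\bar z)=\overline{\varphi(z,\bar z)}$. *)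

(* Defs.v *)
From HB Require Import structures.
From mathcomp Require Import all_boot all_order all_algebra.
From mathcomp Require Import reals.
From mathcomp Require Import complex mpoly.

Set Implicit Arguments.
Unset Strict Implicit.
Unset Printing Implicit Defensive.

Import Order.TTheory GRing.Theory Num.Theory.
Local Open Scope ring_scope.
Local Open Scope complex_scope.

(* A series is its family of coefficients. A series in (z, zbar) has type
   fps R (n + n): variable lshift n i is z_i and variable rshift n i is
   zbar_i. A series in (z, w) has type fps R (n + 1): variable lshift 1 i is
   z_i and variable rshift n ord0 is w. *)
Definition fps (R : realType) (p : nat) := 'X_{1..p} -> R[i].

Definition fps_trunc (R : realType) (p d : nat) (f : fps R p)
  : {mpoly R[i][p]} :=
  \sum_(m : 'X_{1..p < d.+1}) f m *: 'X_[m].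

(* Substitution f(g_0, ..., g_(p-1)), meaningful only when no g_i has a
   constant term: then the coefficient of a monomial of degree d depends only
   on the terms of degree at most d of f and of the g_i. *)
Definition fps_comp (R : realType) (p q : nat) (f : fps R p)
    (g : 'I_p -> fps R q) : fps R q :=
  fun m => (fps_trunc (mdeg m) f
              \mPo [tuple fps_trunc (mdeg m) (g i) | i < p])@_m.

Definition swap_var (n : nat) (i : 'I_(n + n)) : 'I_(n + n) :=
  match split i with inl j => rshift n j | inr j => lshift n j end.

(* Conjugation of a series in (z, zbar): conjugate the coefficients and
   exchange z and zbar. *)
Definition fps_conj (R : realType) (n : nat) (f : fps R (n + n))
  : fps R (n + n) :=
  fun m => (f [multinom m (swap_var i) | i < n + n])^*.

Definition formally_real (R : realType) (n : nat) (f : fps R (n + n)) : Prop :=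
  fps_conj f =1 f.

(* The formal submanifold w = Phi(z, zbar) is represented by Phi. The map
   z |-> (z, Phi(z, zbar)) parametrizes it. *)
Definition graph_param (R : realType) (n : nat) (Phi : fps R (n + n))
    (i : 'I_(n + 1)) : fps R (n + n) :=
  match split i with
  | inl j => fun m => ('X_(lshift n j) : {mpoly R[i][n + n]})@_m
  | inr _ => Phi
  end.

Definition formal_change (R : realType) (n : nat)
    (H : 'I_(n + 1) -> fps R (n + 1)) : Prop :=
  (forall i, H i 0%MM = 0)
  /\ (\matrix_(i, j) H i U_(j)%MM : 'M[R[i]]_(n + 1)) \in unitmx.

(* (z', w') = H(z, w) transforms w = Phi(z, zbar) into w' = Phi'(z', zbar'):
   the equation w' = Phi'(z', zbar') becomes an identity of series in
   (z, zbar) once (z', w') = H(z, Phi(z, zbar)). For an invertible H this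
   says that the two defining ideals correspond, since both submanifolds are
   graphs over n complex variables. *)
Definition transforms (R : realType) (n : nat)
    (H : 'I_(n + 1) -> fps R (n + 1)) (Phi Phi' : fps R (n + n)) : Prop :=
  let H_M i := fps_comp (H i) (graph_param Phi) in
  H_M (rshift n ord0) =1
  fps_comp Phi' (fun i : 'I_(n + n) =>
    match split i with
    | inl j => H_M (lshift 1 j)
    | inr j => fps_conj (H_M (lshift 1 j))
    end).

Definition formally_equivalent (R : realType) (n : nat)
    (Phi Phi' : fps R (n + n)) : Prop :=
  exists2 H, formal_change H & transforms H Phi Phi'.

Definition flattenable (R : realType) (n : nat) (Phi : fps R (n + n)) : Prop :=
  exists2 Estar, formally_equivalent Phi Estar & formally_real Estar.

Definition sqnorm (R : realType) (n : nat) (l : 'I_n) : {mpoly R[i][n + n]} :=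
  'X_(lshift n l) * 'X_(rshift n l).

(* u for k = 0, and v_(k+1) in one-based indexing otherwise. *)
Definition uv (R : realType) (n : nat) (k : 'I_n) : {mpoly R[i][n + n]} :=
  if k == 0 :> nat then \sum_(l < n) sqnorm R l
  else \sum_(l < n | (l < k)%N) sqnorm R l - sqnorm R k.

Definition quadric_plus (R : realType) (n : nat) (E : fps R (n + n))
  : fps R (n + n) :=
  fun m => (\sum_(l < n) sqnorm R l)@_m + E m.

Definition order_ge3 (R : realType) (n : nat) (f : fps R (n + n)) : Prop :=
  forall m, (mdeg m < 3)%N -> f m = 0.

Definition coef_family (R : realType) (n : nat) :=
  'X_{1..n} -> 'X_{1..n} -> 'X_{1..n} -> R[i].

Definition basis_term (R : realType) (n : nat) (I J K : 'X_{1..n})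
  : {mpoly R[i][n + n]} :=
  (\prod_(l < n) 'X_(lshift n l) ^+ I l) *
  (\prod_(l < n) 'X_(rshift n l) ^+ J l) *
  (\prod_(l < n) uv R l ^+ K l).

(* phi is the sum of c I J K z^I zbar^J u^k_1 v_2^k_2 ... v_n^k_n over the
   I, J, K with i_l j_l = 0 for all l. The basis term is homogeneous of degree
   |I| + |J| + 2|K|, so at the monomial m the sum may be restricted to I, J, K
   of degree at most |m|. *)
Definition is_expansion (R : realType) (n : nat) (phi : fps R (n + n))
    (c : coef_family R n) : Prop :=
  forall m : 'X_{1..n + n},
    phi m = \sum_(I : 'X_{1..n < (mdeg m).+1})
            \sum_(J : 'X_{1..n < (mdeg m).+1} |
                   [forall l, (bmnm I l * bmnm J l == 0)%N])
            \sum_(K : 'X_{1..n < (mdeg m).+1})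
              c I J K * (basis_term R I J K)@_m.

Definition e1 (n : nat) : 'X_{1..n} :=
  [multinom nat_of_bool (i == 0 :> nat) | i < n].

(* One-based 2 <= i <= n becomes 0 < i for i : 'I_n. *)
Definition normalized (R : realType) (n : nat) (c : coef_family R n) : Prop :=
  [/\ forall t, (2 <= t)%N -> c 0%MM 0%MM (e1 n *+ t)%MM = 0,
      forall l (i : 'I_n), (1 <= l)%N -> (0 < i)%N ->
        complex.Re (c 0%MM 0%MM (e1 n *+ l + U_(i))%MM) = 0,
      forall l (i j : 'I_n), (1 <= l)%N -> (j < i)%N ->
        c U_(i)%MM U_(j)%MM (e1 n *+ l)%MM = 0,
      forall (I : 'X_{1..n}), (1 <= mdeg I)%N ->
        [/\ forall l, (1 <= l)%N -> c I 0%MM (e1 n *+ l)%MM = 0,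
            forall l, (1 <= l)%N -> c 0%MM I (e1 n *+ l)%MM = 0
          & forall k (j : 'I_n), (0 < j)%N ->
              c 0%MM I (e1 n *+ k + U_(j))%MM = 0]
    & (forall k (h : 'I_n) (I : 'X_{1..n}), (2 <= mdeg I)%N -> I h = 0%N ->
         c I U_(h)%MM (e1 n *+ k)%MM = 0)
      /\ (forall I : 'X_{1..n}, (2 < mdeg I)%N ->
         c 0%MM I 0%MM = (c I 0%MM 0%MM)^*)].

(* w = |z|^2 + phi(z, zbar) is a pseudo-normal form of w = Phi(z, zbar). *)
Definition pseudo_normal_form (R : realType) (n : nat)
    (Phi phi : fps R (n + n)) : Prop :=
  [/\ order_ge3 phi,
      exists2 c, is_expansion phi c & normalized c
    & formally_equivalent Phi (quadric_plus phi)].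

(* Main.v *)
Require Import Defs.
From HB Require Import structures.
From mathcomp Require Import all_boot all_order all_algebra.
From mathcomp Require Import reals.
From mathcomp Require Import complex mpoly.
From mathcomp Require Import boolp.
From mathcomp Require Import zify ring.

(** Give z weight 1 and w weight 2, so that restricting a holomorphic series to
    the quadric w = |z|^2 turns weight into degree. In each degree d >= 3 a
    change of coordinates (z + f, w + g) alters the defining function by
    g(z, |z|^2) - 2 Re <f(z, |z|^2), z> modulo higher degree, and every term
    forbidden in a pseudo-normal form can be absorbed by such an expression, so
    a pseudo-normal form always exists.

    Conversely suppose M maps to a real graph by H and to a pseudo-normal form
    phi by H'. The w-component G of H is real on M and starts with c w, c real
    and nonzero; if phi is real in degrees < d, subtracting a real polynomial
    in G from the w-component of H' leaves a series of weight >= d. Hence in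
    degree d, after a dilated unitary change of z, phi - conj phi is
    h(z, |z|^2) - conj h(z, |z|^2) for a holomorphic h, and the normalization
    of the corresponding coefficients makes it vanish. So every pseudo-normal
    form of a flattenable M is real, without inverting or composing changes of
    coordinates. *)

(** Series are replaced by polynomials that agree with them below a chosen degree, and every
    estimate records by how much order a perturbation exceeds the leading degree. On M, w differs
    from |z|^2 only in degree 3, so passing from M to the quadric does not affect the leading part
    of a restriction. On the quadric w = u, hence z^I w^k restricts to the single expansion term z^I
    u^k. Restriction thus causes no cancellation, and the leading part of a real restriction is a
    w^k with a real. For the same reason h - conj h only involves the indices (I, 0, k e_1) and (0,
    I, k e_1), where the normalization prescribes zero or conjugate values. The flattening and the
    normalizing change need not be related to each other; comparing their w-components as two
    functions on M removes the need to relate them. The dilated unitary appears because degree 2 of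
    w' = |z'|^2 + ... on M forces |Az|^2 = c'|z|^2 for the z-linear part A of z'. *)

Set Implicit Arguments.
Unset Strict Implicit.
Unset Printing Implicit Defensive.

Import Order.TTheory GRing.Theory Num.Theory.
Local Open Scope ring_scope.
Local Open Scope complex_scope.

(** * Substitution and order of vanishing of polynomials *)

Section Substitution.
Context (A : comNzRingType).

(* Opaque, since unification in a rewriting step would otherwise unfold the
   polynomial arithmetic. *)
Fact subst_subproof p k (q : 'I_p -> {mpoly A[k]}) :
  {h : {mpoly A[p]} -> {mpoly A[k]} | forall f, h f = f \mPo [tuple q i | i < p]}.
Proof. by exists (comp_mpoly [tuple q i | i < p]). Qed.
Definition subst p k (q : 'I_p -> {mpoly A[k]}) : {mpoly A[p]} -> {mpoly A[k]} :=
  sval (subst_subproof q).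

Lemma subst_mPo p k (q : 'I_p -> {mpoly A[k]}) f :
  subst q f = f \mPo [tuple q i | i < p].
Proof. exact: (svalP (subst_subproof q)). Qed.

Fact subst_is_zmod_morphism p k (q : 'I_p -> {mpoly A[k]}) : zmod_morphism (subst q).
Proof. by move=> f g; rewrite !subst_mPo raddfB. Qed.

Fact subst_is_monoid_morphism p k (q : 'I_p -> {mpoly A[k]}) : monoid_morphism (subst q).
Proof. by split=> [|f g]; rewrite !subst_mPo ?rmorph1 ?rmorphM. Qed.

HB.instance Definition _ p k (q : 'I_p -> {mpoly A[k]}) :=
  GRing.isZmodMorphism.Build _ _ (subst q) (subst_is_zmod_morphism q).
HB.instance Definition _ p k (q : 'I_p -> {mpoly A[k]}) :=
  GRing.isMonoidMorphism.Build _ _ (subst q) (subst_is_monoid_morphism q).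

Lemma substD p k (q : 'I_p -> {mpoly A[k]}) : {morph subst q : f g / f + g}.
Proof. exact: raddfD. Qed.

Lemma substZ p k (q : 'I_p -> {mpoly A[k]}) c f : subst q (c *: f) = c *: subst q f.
Proof. by rewrite !subst_mPo comp_mpolyZ. Qed.

Lemma substXm p k (q : 'I_p -> {mpoly A[k]}) m :
  subst q 'X_[m] = \prod_(i < p) q i ^+ m i.
Proof. by rewrite subst_mPo comp_mpolyX; apply: eq_bigr => i _; rewrite tnth_mktuple. Qed.

Lemma substX p k (q : 'I_p -> {mpoly A[k]}) i : subst q 'X_i = q i.
Proof. by rewrite subst_mPo comp_mpolyXU nth_mktuple. Qed.

Lemma substE p k (q : 'I_p -> {mpoly A[k]}) f :
  subst q f = \sum_(m <- msupp f) f@_m *: \prod_(i < p) q i ^+ m i.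
Proof.
by rewrite {1}[f]mpolyE raddf_sum /=; apply: eq_bigr => m _; rewrite substZ substXm.
Qed.

Lemma eq_subst p k (q q' : 'I_p -> {mpoly A[k]}) f :
  q =1 q' -> subst q f = subst q' f.
Proof.
move=> e; rewrite !substE; apply: eq_bigr => m _; congr (_ *: _).
by apply: eq_bigr => i _; rewrite e.
Qed.

Lemma substA p k l (q : 'I_p -> {mpoly A[k]}) (r : 'I_k -> {mpoly A[l]}) f :
  subst r (subst q f) = subst (fun i => subst r (q i)) f.
Proof.
rewrite (substE q) raddf_sum (substE _ f) /=; apply: eq_bigr => m _.
rewrite substZ rmorph_prod /=; congr (_ *: _).
by apply: eq_bigr => i _; rewrite rmorphXn.
Qed.

Lemma subst_id p (f : {mpoly A[p]}) : subst (fun i => 'X_i) f = f.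
Proof. by rewrite subst_mPo comp_mpoly_id. Qed.

Definition ord p (s : nat) (f : {mpoly A[p]}) : Prop :=
  forall m, (mdeg m < s)%N -> f@_m = 0.

(** Two quantities of order s that agree to D further degrees. Under products the orders add and the
    precision D is kept, so a single D runs through a whole substitution. *)
Definition rel p (s D : nat) (f g : {mpoly A[p]}) : Prop :=
  [/\ ord s f, ord s g & ord (s + D) (f - g)].

Section Order.
Context (p : nat).
Implicit Types f g : {mpoly A[p]}.

Lemma ord_ge0 f : ord 0 f. Proof. by []. Qed.

Lemma ord_0 s : ord s (0 : {mpoly A[p]}).
Proof. by move=> m _; rewrite mcoeff0. Qed.

Lemma ord_le s t f : (t <= s)%N -> ord s f -> ord t f.
Proof. by move=> le h m hm; apply/h/leq_trans/le. Qed.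

Lemma ordD s f g : ord s f -> ord s g -> ord s (f + g).
Proof. by move=> hf hg m hm; rewrite mcoeffD hf ?hg ?addr0. Qed.

Lemma ordN s f : ord s f -> ord s (- f).
Proof. by move=> hf m hm; rewrite mcoeffN hf ?oppr0. Qed.

Lemma ordB s f g : ord s f -> ord s g -> ord s (f - g).
Proof. by move=> hf hg; apply/ordD/ordN. Qed.

Lemma ordZ s c f : ord s f -> ord s (c *: f).
Proof. by move=> hf m hm; rewrite mcoeffZ hf ?mulr0. Qed.

Lemma ord_sum s I (r : seq I) (P : pred I) (F : I -> {mpoly A[p]}) :
  (forall i, P i -> ord s (F i)) -> ord s (\sum_(i <- r | P i) F i).
Proof. by move=> h; apply: big_ind => //; [exact: ord_0 | exact: ordD]. Qed.

Lemma ordM s t f g : ord s f -> ord t g -> ord (s + t) (f * g).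
Proof.
move=> hf hg m hm; rewrite mcoeffM big1 // => -[k1 k2] /= /eqP e.
have := congr1 (@mdeg p) e; rewrite mdegD => e'.
case: (ltnP (mdeg k1) s) => h1; first by rewrite hf ?mul0r.
by rewrite hg ?mulr0 //; lia.
Qed.

Lemma ordXm m : ord (mdeg m) ('X_[m] : {mpoly A[p]}).
Proof. by move=> k hk; rewrite mcoeffX; case: eqP => // e; move: hk; rewrite e ltnn. Qed.

Lemma ordX i : ord 1 ('X_i : {mpoly A[p]}).
Proof. by have := @ordXm U_(i); rewrite mdeg1. Qed.

Lemma rel_refl s D f : ord s f -> rel s D f f.
Proof. by move=> h; split => //; rewrite subrr; apply: ord_0. Qed.

Lemma rel0 D f g : ord D (f - g) -> rel 0 D f g.
Proof. by []. Qed.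

Lemma relM s t D f f' g g' :
  rel s D f f' -> rel t D g g' -> rel (s + t) D (f * g) (f' * g').
Proof.
move=> [f1 f2 f3] [g1 g2 g3]; split; try exact: ordM.
have -> : f * g - f' * g' = f * (g - g') + (f - f') * g' by ring.
by apply: ordD; [rewrite -addnA | rewrite addnAC]; apply: ordM.
Qed.

Lemma relX s D f g k : rel s D f g -> rel (s * k) D (f ^+ k) (g ^+ k).
Proof.
move=> h; elim: k => [|k IH]; first by rewrite muln0 !expr0; apply/rel_refl/ord_ge0.
by rewrite mulnS !exprS; apply: relM.
Qed.

Lemma rel_prod D I (r : seq I) (w : I -> nat) (F G : I -> {mpoly A[p]}) :
  (forall i, rel (w i) D (F i) (G i)) ->
  rel (\sum_(i <- r) w i) D (\prod_(i <- r) F i) (\prod_(i <- r) G i).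
Proof.
move=> h; elim: r => [|i r IH]; first by rewrite !big_nil; apply/rel_refl/ord_ge0.
by rewrite !big_cons; apply: relM.
Qed.

Lemma relW s t D f g : (t <= s)%N -> rel s D f g -> rel t D f g.
Proof.
move=> le [h1 h2 h3]; split; [exact: ord_le h1|exact: ord_le h2|].
by apply: ord_le h3; lia.
Qed.

End Order.

(** The i-th argument has weight [w i]. The weights are taken all 1 to count degree, all 0 for a
    plain congruence, and [wt] for polynomials in (z, w). *)
Lemma rel_subst p k (w : 'I_p -> nat) s D (q q' : 'I_p -> {mpoly A[k]}) f :
  (forall i, rel (w i) D (q i) (q' i)) ->
  (forall m, f@_m != 0 -> (s <= \sum_i w i * m i)%N) ->
  rel s D (subst q f) (subst q' f).
Proof.
move=> hq hf.
have h m : m \in msupp f -> rel s D (\prod_i q i ^+ m i) (\prod_i q' i ^+ m i).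
  rewrite mcoeff_msupp => /hf /relW; apply.
  by apply: rel_prod => i; apply: relX.
rewrite !substE; split; try by
  rewrite big_seq; apply: ord_sum => m /h [h1 h2 h3]; apply: ordZ.
rewrite -sumrB big_seq; apply: ord_sum => m /h [h1 h2 h3].
by rewrite -scalerBr; apply: ordZ.
Qed.

Lemma ord_supp p s (f : {mpoly A[p]}) m : ord s f -> f@_m != 0 -> (s <= mdeg m)%N.
Proof. by move=> h; case: leqP => // /h ->; rewrite eqxx. Qed.

Lemma ord_subst_rel p k s D (q q' : 'I_p -> {mpoly A[k]}) f :
  (forall i, rel 1 D (q i) (q' i)) -> ord s f -> rel s D (subst q f) (subst q' f).
Proof.
move=> hq hf; apply: (rel_subst (w := fun=> 1%N)) => // m /(ord_supp hf).
by rewrite mdegE; under [X in _ -> (_ <= X)%N]eq_bigr do rewrite mul1n.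
Qed.

Lemma ord_subst p k s (q : 'I_p -> {mpoly A[k]}) f :
  (forall i, ord 1 (q i)) -> ord s f -> ord s (subst q f).
Proof.
by move=> hq hf; case: (@ord_subst_rel _ _ s 0 q q f) => // i; apply: rel_refl.
Qed.

Lemma ord_subst_congr p k s (q q' : 'I_p -> {mpoly A[k]}) f :
  (forall i, ord s (q i - q' i)) -> ord s (subst q f - subst q' f).
Proof.
move=> hq; by case: (@rel_subst _ _ (fun=> 0%N) 0 s q q' f).
Qed.

Lemma ord_subst_congr2 p k s (q q' : 'I_p -> {mpoly A[k]}) f f' :
  (forall i, ord 1 (q i)) -> (forall i, ord s (q i - q' i)) -> ord s (f - f') ->
  ord s (subst q f - subst q' f').
Proof.
move=> h1 hq hf; rewrite -(subrK (subst q f') (subst q f)) -addrA -raddfB.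
by apply: ordD; [apply: ord_subst | apply: ord_subst_congr].
Qed.

End Substitution.

(** * Formal series and conjugation *)

(** Same match on [split] as in [graph_param] and [transforms], which are therefore convertible to
    instances of it. *)
Definition pairv m n T (a : 'I_m -> T) (b : 'I_n -> T) (i : 'I_(m + n)) : T :=
  match split i with inl j => a j | inr j => b j end.

Lemma pairvL m n T (a : 'I_m -> T) (b : 'I_n -> T) j : pairv a b (lshift n j) = a j.
Proof. by rewrite /pairv (unsplitK (inl j)). Qed.

Lemma pairvR m n T (a : 'I_m -> T) (b : 'I_n -> T) j : pairv a b (rshift m j) = b j.
Proof. by rewrite /pairv (unsplitK (inr j)). Qed.

Lemma pairvP m n T (a : 'I_m -> T) (b : 'I_n -> T) f :
  (forall j, f (lshift n j) = a j) -> (forall j, f (rshift m j) = b j) ->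
  f =1 pairv a b.
Proof. by move=> ha hb i; case: (split_ordP i) => j ->; rewrite ?pairvL ?pairvR. Qed.

Lemma swap_varL n (j : 'I_n) : swap_var (lshift n j) = rshift n j.
Proof. by rewrite /swap_var (unsplitK (inl j)). Qed.

Lemma swap_varR n (j : 'I_n) : swap_var (rshift n j) = lshift n j.
Proof. by rewrite /swap_var (unsplitK (inr j)). Qed.

Lemma swap_varK n : involutive (@swap_var n).
Proof. by move=> i; case: (split_ordP i) => j ->; rewrite ?(swap_varL, swap_varR). Qed.

Definition mswap n (m : 'X_{1..n + n}) : 'X_{1..n + n} :=
  [multinom m (swap_var i) | i < n + n].

Lemma mswapK n : involutive (@mswap n).
Proof. by move=> m; apply/mnmP => i; rewrite !mnmE swap_varK. Qed.

Lemma mdeg_mswap n (m : 'X_{1..n + n}) : mdeg (mswap m) = mdeg m.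
Proof.
rewrite !mdegE [RHS](reindex_inj (inv_inj (@swap_varK n))).
by apply: eq_bigr => i _; rewrite mnmE.
Qed.

Section Series.
Context (R : realType).
Local Notation C := R[i].

Definition agree p d (P : {mpoly C[p]}) (f : fps R p) : Prop :=
  forall m, (mdeg m < d)%N -> P@_m = f m.

Lemma fps_truncE p d (f : fps R p) m :
  (fps_trunc d f)@_m = if (mdeg m <= d)%N then f m else 0.
Proof.
case: leqP => hm; first by rewrite /fps_trunc mcoeff_mpoly.
rewrite /fps_trunc raddf_sum big1 // => -[k hk] _ /=.
rewrite mcoeffZ mcoeffX; case: eqP => [e|]; last by rewrite mulr0.
by move: hm; rewrite -e ltnNge -ltnS hk.
Qed.

Lemma agree_trunc p d (f : fps R p) : agree d.+1 (fps_trunc d f) f.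
Proof. by move=> m hm; rewrite fps_truncE -ltnS hm. Qed.

Lemma agree_le p d e (P : {mpoly C[p]}) f : (e <= d)%N -> agree d P f -> agree e P f.
Proof. by move=> le h m hm; apply/h/leq_trans/le. Qed.

Lemma agree_ord p d (P Q : {mpoly C[p]}) f : agree d P f -> agree d Q f -> ord d (P - Q).
Proof. by move=> hP hQ m hm; rewrite mcoeffB hP ?hQ ?subrr. Qed.

Lemma ord_agree p d (P Q : {mpoly C[p]}) f : agree d P f -> ord d (Q - P) -> agree d Q f.
Proof. by move=> hP hQ m hm; rewrite -hP //; apply/subr0_eq; rewrite -mcoeffB hQ. Qed.

Lemma agree_ord1 p d (P : {mpoly C[p]}) f :
  f 0%MM = 0 -> agree d.+1 P f -> ord 1 P.
Proof.
move=> f0 h m; rewrite ltnS leqn0 => hm; rewrite h; last by rewrite (eqP hm).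
by move: hm; rewrite mdeg_eq0 => /eqP ->.
Qed.

(** [fps_comp] truncates at a different degree for each coefficient. As the [g i] have no constant
    term, polynomials that agree with the data below one fixed d give the same coefficients
    there. *)
Lemma agree_comp p q d (f : fps R p) (g : 'I_p -> fps R q) P (Q : 'I_p -> {mpoly C[q]}) :
  (forall i, g i 0%MM = 0) -> agree d P f -> (forall i, agree d (Q i) (g i)) ->
  agree d (subst Q P) (fps_comp f g).
Proof.
move=> g0 hP hQ m hm; have tr f' := @agree_trunc q (mdeg m) f'.
have {}hP := agree_le hm hP; have {}hQ i := agree_le hm (hQ i).
apply/subr0_eq; rewrite /fps_comp -subst_mPo -mcoeffB.
apply: (@ord_subst_congr2 _ _ _ (mdeg m).+1) => // [i|i|].
- exact: (agree_ord1 (g0 i) (hQ i)).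
- exact: agree_ord (hQ i) (tr _).
- exact: agree_ord hP (agree_trunc _).
Qed.

Lemma fps_comp0 p q (f : fps R p) (g : 'I_p -> fps R q) :
  fps_comp f g 0%MM = f 0%MM.
Proof.
rewrite /fps_comp mdeg0; have -> : fps_trunc 0 f = (f 0%MM)%:MP.
  apply/mpolyP => m; rewrite fps_truncE leqn0 mdeg_eq0 mcoeffC.
  by case: eqP => [->|]; rewrite ?mulr1 ?mulr0.
by rewrite comp_mpolyC mcoeffC eqxx mulr1.
Qed.

Lemma conjcD (x y : C) : conjc (x + y) = conjc x + conjc y.
Proof. by rewrite raddfD. Qed.
Lemma conjcB (x y : C) : conjc (x - y) = conjc x - conjc y.
Proof. by rewrite raddfB. Qed.
Lemma conjcM (x y : C) : conjc (x * y) = conjc x * conjc y.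
Proof. by rewrite rmorphM. Qed.

Section Conj.
Context (n : nat).
Implicit Types f g : {mpoly C[n + n]}.

Fact cj_subproof : {h : {mpoly C[n + n]} -> {mpoly C[n + n]} |
  forall f, h f = subst (fun i => 'X_(swap_var i)) (map_mpoly conjc f)}.
Proof. by exists (fun f => subst (fun i => 'X_(swap_var i)) (map_mpoly conjc f)). Qed.
Definition cj : {mpoly C[n + n]} -> {mpoly C[n + n]} := sval cj_subproof.

Lemma cj_def f : cj f = subst (fun i => 'X_(swap_var i)) (map_mpoly conjc f).
Proof. exact: (svalP cj_subproof). Qed.

Fact cj_is_zmod_morphism : zmod_morphism cj.
Proof. by move=> f g; rewrite !cj_def !raddfB. Qed.

Fact cj_is_monoid_morphism : monoid_morphism cj.
Proof. by split=> [|f g]; rewrite !cj_def ?rmorph1 ?rmorphM. Qed.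

HB.instance Definition _ := GRing.isZmodMorphism.Build _ _ cj cj_is_zmod_morphism.
HB.instance Definition _ := GRing.isMonoidMorphism.Build _ _ cj cj_is_monoid_morphism.

Lemma cj0 : cj 0 = 0. Proof. exact: raddf0. Qed.
Lemma cjD : {morph cj : f g / f + g}. Proof. exact: raddfD. Qed.
Lemma cjB : {morph cj : f g / f - g}. Proof. exact: raddfB. Qed.
Lemma cjM : {morph cj : f g / f * g}. Proof. exact: rmorphM. Qed.

Lemma cjZ c f : cj (c *: f) = conjc c *: cj f.
Proof. by rewrite !cj_def map_mpolyZ substZ. Qed.

Lemma cjXm m : cj 'X_[m] = 'X_[mswap m].
Proof.
rewrite cj_def map_mpolyX substXm [RHS]mpolyXE_id.
rewrite [RHS](reindex_inj (inv_inj (@swap_varK n))).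
by apply: eq_bigr => i _; rewrite mnmE swap_varK.
Qed.

Lemma cjX i : cj 'X_i = 'X_(swap_var i).
Proof.
rewrite cjXm; congr mpolyX; apply/mnmP => j; rewrite !mnmE.
by congr nat_of_bool; apply/eqP/eqP => [->|<-]; rewrite ?swap_varK.
Qed.

Lemma cjE m f : (cj f)@_m = conjc f@_(mswap m).
Proof.
elim/mpolyind: f => [|c k f _ _ IH]; first by rewrite cj0 !mcoeff0 conjc0.
rewrite cjD !mcoeffD IH conjcD; congr (_ + _).
rewrite cjZ cjXm !mcoeffZ !mcoeffX conjcM conjc_nat.
by rewrite (can2_eq (@mswapK n) (@mswapK n)).
Qed.

Lemma cjK : involutive cj.
Proof. by move=> f; apply/mpolyP => m; rewrite !cjE mswapK conjcK. Qed.

Lemma ord_cj s f : ord s f -> ord s (cj f).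
Proof. by move=> h m hm; rewrite cjE h ?conjc0 // mdeg_mswap. Qed.

Lemma agree_conj d f (F : fps R (n + n)) : agree d f F -> agree d (cj f) (fps_conj F).
Proof. by move=> h m hm; rewrite cjE h ?mdeg_mswap. Qed.

Lemma cj_subst p (q : 'I_p -> {mpoly C[n + n]}) (P : {mpoly C[p]}) :
  cj (subst q P) = subst (cj \o q) (map_mpoly conjc P).
Proof.
elim/mpolyind: P => [|c k P _ _ IH]; first by rewrite !rmorph0.
rewrite !rmorphD /= IH; congr (_ + _).
rewrite map_mpolyZ map_mpolyX !substZ cjZ !substXm rmorph_prod /=; congr (_ *: _).
by apply: eq_bigr => i _; rewrite rmorphXn.
Qed.

Lemma subst_cj (q : 'I_(n + n) -> {mpoly C[n + n]}) f :
  (forall i, q (swap_var i) = cj (q i)) -> subst q (cj f) = cj (subst q f).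
Proof.
by move=> h; rewrite cj_subst cj_def substA; apply: eq_subst => i; rewrite substX h.
Qed.

End Conj.
End Series.

(** * Coefficients of the expansion in u, v_2, ..., v_n *)

Definition lin (R : comNzRingType) n p (T : 'M[R]_(n, p)) (i : 'I_n) : {mpoly R[p]} :=
  \sum_j T i j *: 'X_j.

Lemma ord_lin (R : comNzRingType) n p (T : 'M[R]_(n, p)) i : ord 1 (lin T i).
Proof. by apply: ord_sum => j _; apply/ordZ/ordX. Qed.

Lemma subst_lin (R : comNzRingType) n p q (T : 'M[R]_(n, p)) (S : 'M[R]_(p, q)) i :
  subst (lin S) (lin T i) = lin (T *m S) i.
Proof.
rewrite /lin raddf_sum /=.
under eq_bigr do rewrite substZ substX scaler_sumr.
rewrite exchange_big; apply: eq_bigr => k _ /=.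
by rewrite mxE scaler_suml; apply: eq_bigr => j _; rewrite scalerA.
Qed.

Lemma lin1 (R : comNzRingType) n i : lin (1%:M : 'M[R]_n) i = 'X_i.
Proof.
rewrite /lin (bigD1 i) //= big1 ?addr0 ?mxE ?eqxx ?scale1r // => j /negbTE ne.
by rewrite mxE eq_sym ne scale0r.
Qed.

Definition mjoin n (I J : 'X_{1..n}) : 'X_{1..n + n} :=
  [multinom pairv I J i | i < n + n].

Definition disjm n (I J : 'X_{1..n}) : bool := [forall l, (I l * J l == 0)%N].

Section Mjoin.
Context (n : nat).
Implicit Types I J M : 'X_{1..n}.

Lemma mjoinL I J l : mjoin I J (lshift n l) = I l.
Proof. by rewrite mnmE pairvL. Qed.

Lemma mjoinR I J l : mjoin I J (rshift n l) = J l.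
Proof. by rewrite mnmE pairvR. Qed.

Lemma mjoinP (m : 'X_{1..n + n}) I J :
  (forall l, m (lshift n l) = I l) -> (forall l, m (rshift n l) = J l) -> m = mjoin I J.
Proof. by move=> hI hJ; apply/mnmP => i; rewrite mnmE; apply: pairvP. Qed.

Lemma mjoinD I J I' J' : (mjoin I J + mjoin I' J' = mjoin (I + I') (J + J'))%MM.
Proof. by apply: mjoinP => l; rewrite !mnmDE !(mjoinL, mjoinR). Qed.

Lemma mjoin_inj I J I' J' : mjoin I J = mjoin I' J' -> I = I' /\ J = J'.
Proof.
by move=> e; split; apply/mnmP => l;
  [rewrite -(mjoinL I J) e mjoinL | rewrite -(mjoinR I J) e mjoinR].
Qed.

Lemma mdeg_mjoin I J : mdeg (mjoin I J) = (mdeg I + mdeg J)%N.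
Proof.
rewrite !mdegE big_split_ord /=.
by congr addn; apply: eq_bigr => l _; rewrite !(mjoinL, mjoinR).
Qed.

Lemma mswap_mjoin I J : mswap (mjoin I J) = mjoin J I.
Proof.
by apply: mjoinP => l; rewrite mnmE ?swap_varL ?swap_varR ?mjoinL ?mjoinR.
Qed.

Lemma disjmP I J : reflect (forall l, I l = 0%N \/ J l = 0%N) (disjm I J).
Proof.
apply: (iffP forallP) => h l; have := h l.
  by rewrite muln_eq0 => /orP [/eqP ->|/eqP ->]; auto.
by case=> ->; rewrite ?muln0.
Qed.

Lemma disjmC I J : disjm I J = disjm J I.
Proof. by apply: eq_forallb => l; rewrite mulnC. Qed.

(** Removing the common powers of z_l and zbar_l leaves disjoint exponents: a series is a sum of z^I
    zbar^J times series in the |z_l|^2. *)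
Lemma mjoin_split (m : 'X_{1..n + n}) :
  exists I J M, disjm I J /\ m = (mjoin I J + mjoin M M)%MM.
Proof.
pose M := [multinom minn (m (lshift n l)) (m (rshift n l)) | l < n].
exists [multinom (m (lshift n l) - M l)%N | l < n].
exists [multinom (m (rshift n l) - M l)%N | l < n], M; split.
  by apply/disjmP => l; rewrite !mnmE; lia.
by rewrite mjoinD; apply: mjoinP => l; rewrite mnmDE !mnmE; lia.
Qed.

Lemma mjoin_split_inj I J M I' J' M' : disjm I J -> disjm I' J' ->
  (mjoin I J + mjoin M M = mjoin I' J' + mjoin M' M')%MM -> [/\ I = I', J = J' & M = M'].
Proof.
move=> /disjmP d /disjmP d'; rewrite !mjoinD => /mjoin_inj [/mnmP e1 /mnmP e2].
by split; apply/mnmP => l; have := d l; have := d' l; have := e1 l; have := e2 l;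
  rewrite !mnmDE; lia.
Qed.

End Mjoin.

Section Expansion.
Context (R : realType) (n : nat).
Local Notation C := R[i].
Implicit Types I J K M : 'X_{1..n}.

Definition uv_mx : 'M[C]_n :=
  \matrix_(k, l) if k == 0 :> nat then 1 else (l < k)%N%:R - (l == k)%:R.

(** A kernel vector v with partial sums s_k has v_k = s_k for k > 0, hence s_(k+1) = 2 s_k, while
    the row of u gives s_n = 0. Descending from s_n, every s_k with k > 0 vanishes, and so does
    v. *)
Lemma uv_mx_unit : uv_mx \in unitmx.
Proof.
rewrite -unitmx_tr -row_free_unit -kermx_eq0; apply/rowV0P => v.
move=> /sub_kermxP /rowP h.
pose s k := \sum_(l < n | (l < k)%N) v 0 l.
have sS (k : 'I_n) : s k.+1 = s k + v 0 k.
  rewrite /s (bigD1 k) //= addrC; congr (_ + _); apply: eq_bigl => l.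
  by rewrite -val_eqE /=; lia.
have hv (k : 'I_n) : (0 < k)%N -> v 0 k = s k.
  move=> k0; move: (h k); rewrite !mxE.
  rewrite (eq_bigr (fun l : 'I_n =>
      (if (l < k)%N then v 0 l else 0) - (if l == k then v 0 l else 0))).
    rewrite sumrB -!big_mkcond /= big_pred1_eq => /eqP.
    by rewrite subr_eq0 => /eqP.
  move=> l _; rewrite !mxE (gtn_eqF k0).
  by case: (l < k)%N; case: (l == k); rewrite /= ?(subr0, subrr, mulr1, mulr0, sub0r, mulrN).
have h0 : s n = 0.
  case: (posnP n) => n0; first by rewrite /s big1 // => l; have := ltn_ord l; lia.
  have := h (Ordinal n0); rewrite !mxE => e; rewrite -[RHS]e /s.
  by apply: eq_big => [l|l _]; rewrite ?ltn_ord // !mxE mulr1.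
have hs j : (j < n)%N -> s (n - j)%N = 0.
  elim: j => [|j IH] hj; first by rewrite subn0.
  have lt : (n - j.+1 < n)%N by lia.
  have := sS (Ordinal lt); rewrite hv /=; last by lia.
  have -> : (n - j.+1).+1 = (n - j)%N by lia.
  by rewrite IH ?(ltnW hj) // => /eqP; rewrite eq_sym -mulr2n mulrn_eq0 => /eqP.
apply/rowP => k; rewrite mxE; case: (posnP k) => k0.
  have := sS k; rewrite k0 {2}/s big1 // add0r => <-.
  have -> : 1%N = (n - n.-1)%N by have := ltn_ord k; lia.
  by apply: hs; have := ltn_ord k; lia.
rewrite hv //; have -> : nat_of_ord k = (n - (n - k))%N by have := ltn_ord k; lia.
by apply: hs; have := ltn_ord k; lia.
Qed.

Definition uvX := lin uv_mx.
(* |z_l|^2 as a linear form in u, v_2, ..., v_n. *)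
Definition xuv := lin (invmx uv_mx).

Lemma subst_xuvK P : subst uvX (subst xuv P) = P.
Proof.
rewrite substA -[RHS]subst_id; apply: eq_subst => i.
by rewrite /uvX subst_lin mulVmx ?uv_mx_unit // lin1.
Qed.

Lemma subst_uvXK P : subst xuv (subst uvX P) = P.
Proof.
rewrite substA -[RHS]subst_id; apply: eq_subst => i.
by rewrite /xuv subst_lin mulmxV ?uv_mx_unit // lin1.
Qed.

(** The forms u, v_k are real, so conjugating an expansion exchanges I and J without touching K, as
    [lam_conj] states. *)
Lemma map_conjc_xuv l : map_mpoly conjc (xuv l) = xuv l.
Proof.
rewrite raddf_sum /=; apply: eq_bigr => k _; rewrite map_mpolyZ map_mpolyX.
congr (_ *: _); have : map_mx conjc (invmx uv_mx) = invmx uv_mx.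
  rewrite map_invmx; congr invmx; apply/matrixP => i j; rewrite !mxE.
  by case: (_ == _); rewrite ?rmorph1 // rmorphB /= !conjc_nat.
by move=> {2}<-; rewrite mxE.
Qed.

Definition sqn : {mpoly C[n]} -> {mpoly C[n + n]} := subst (@sqnorm R n).

Lemma sqnXm M : sqn 'X_[M] = 'X_[mjoin M M].
Proof.
rewrite /sqn substXm [RHS]mpolyXE_id big_split_ord /= -big_split /=.
by apply: eq_bigr => l _; rewrite exprMn !(mjoinL, mjoinR).
Qed.

Lemma uvE k : uv R k = sqn (uvX k).
Proof.
rewrite /uv /sqn /uvX /lin raddf_sum /=; case: ifP => k0.
  by apply: eq_bigr => l _; rewrite substZ substX mxE k0 scale1r.
have -> : sqnorm R k = \sum_l if l == k then sqnorm R l else 0.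
  by rewrite -big_mkcond big_pred1_eq.
rewrite big_mkcond -sumrB /=.
apply: eq_bigr => l _; rewrite substZ substX mxE k0 scalerBl /=.
by case: (l < k)%N; case: (l == k); rewrite ?(scale1r, scale0r).
Qed.

Lemma basis_termE I J K :
  basis_term R I J K = 'X_[mjoin I J] * sqn (subst uvX 'X_[K]).
Proof.
rewrite /basis_term; congr (_ * _).
  rewrite mpolyXE_id big_split_ord /=.
  by congr (_ * _); apply: eq_bigr => l _; rewrite !(mjoinL, mjoinR).
rewrite /sqn substXm rmorph_prod /=; apply: eq_bigr => l _.
by rewrite rmorphXn /= uvE.
Qed.

Lemma mcoeff_sqn I J M I' J' (P : {mpoly C[n]}) : disjm I J -> disjm I' J' ->
  ('X_[mjoin I' J'] * sqn P)@_(mjoin I J + mjoin M M) =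
  if (I' == I) && (J' == J) then P@_M else 0.
Proof.
move=> d d'; rewrite /sqn; elim/mpolyind: P => [|c k P _ _ IH].
  by rewrite rmorph0 mulr0 !mcoeff0 if_same.
rewrite rmorphD /= mulrDr !mcoeffD {}IH substZ -/(sqn 'X_[k]) sqnXm.
rewrite -scalerAr -mpolyXD !mcoeffZ !mcoeffX.
have [/eqP/(mjoin_split_inj d' d) [-> -> ->]|ne] := boolP (_ == _ :> 'X_{1..n + n}).
  by rewrite !eqxx.
case: andP => [[/eqP e1 /eqP e2]|_]; last by rewrite mulr0 addr0.
by rewrite (_ : k == M = false) //; apply/eqP => e; rewrite e1 e2 e eqxx in ne.
Qed.

Definition part I J (phi : fps R (n + n)) : fps R n :=
  fun M => phi (mjoin I J + mjoin M M)%MM.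

(** The z^I zbar^J part of phi is a series in the |z_l|^2, rewritten here in u, v_2, ..., v_n. The
    substitution is linear and preserves degree, so truncation at |K| loses nothing. *)
Definition lam (phi : fps R (n + n)) : coef_family R n :=
  fun I J K => (subst xuv (fps_trunc (mdeg K) (part I J phi)))@_K.

Lemma lam_agree d I J (phi : fps R (n + n)) (P : {mpoly C[n]}) :
  agree d P (part I J phi) -> agree d (subst xuv P) (lam phi I J).
Proof.
move=> h K hK; apply/subr0_eq; rewrite -mcoeffB -raddfB.
apply: (@ord_subst _ _ _ (mdeg K).+1) => // [i|]; first exact: ord_lin.
exact: agree_ord (agree_le hK h) (agree_trunc _).
Qed.

Lemma expansion_part (c : coef_family R n) I J M : disjm I J ->
  \sum_(I' : 'X_{1..n < (mdeg (mjoin I J + mjoin M M)).+1})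
   \sum_(J' : 'X_{1..n < (mdeg (mjoin I J + mjoin M M)).+1} |
          [forall l, (bmnm I' l * bmnm J' l == 0)%N])
   \sum_(K : 'X_{1..n < (mdeg (mjoin I J + mjoin M M)).+1})
      c I' J' K * (basis_term R I' J' K)@_(mjoin I J + mjoin M M) =
  (subst uvX (fps_trunc (mdeg M) (c I J)))@_M.
Proof.
move=> d; set m := (mjoin I J + mjoin M M)%MM.
have hm : mdeg m = (mdeg I + mdeg J + (mdeg M + mdeg M))%N.
  by rewrite mdegD !mdeg_mjoin.
have hI : (mdeg I < (mdeg m).+1)%N by rewrite hm; lia.
have hJ : (mdeg J < (mdeg m).+1)%N by rewrite hm; lia.
rewrite (bigD1 (BMultinom hI)) //= [X in _ + X]big1 ?addr0; last first.
  move=> I' ne; rewrite big1 // => J' d'; rewrite big1 // => K _.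
  rewrite basis_termE mcoeff_sqn // (_ : (_ == I) = false) ?mulr0 //.
  by apply: contraNF ne => /eqP e; apply/eqP/val_inj.
rewrite (bigD1 (BMultinom hJ)) //= [X in _ + X]big1 ?addr0; last first.
  move=> J' /andP [d' ne]; rewrite big1 // => K _.
  rewrite basis_termE mcoeff_sqn // (_ : (_ == J) = false) ?andbF ?mulr0 //.
  by apply: contraNF ne => /eqP e; apply/eqP/val_inj.
transitivity (subst uvX (fps_trunc (mdeg m) (c I J)))@_M.
  rewrite /fps_trunc raddf_sum /= raddf_sum /=; apply: eq_bigr => K _.
  by rewrite basis_termE mcoeff_sqn // !eqxx /= substZ mcoeffZ.
(* The sum over K runs up to the degree of the whole monomial; the terms with |K| > |M| have order
   above |M|. *)
apply/subr0_eq; rewrite -mcoeffB -raddfB.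
apply: (@ord_subst _ _ _ (mdeg M).+1) => // [i|]; first exact: ord_lin.
by apply: agree_ord (agree_trunc _); apply: agree_le (agree_trunc _); lia.
Qed.

(** Existence and uniqueness of the expansion. Nothing is claimed about [c] at non-disjoint I, J,
    but all the indices in [normalized] are disjoint. *)
Lemma is_expansionP (phi : fps R (n + n)) c :
  is_expansion phi c <-> (forall I J, disjm I J -> c I J =1 lam phi I J).
Proof.
split=> [h I J d K|h m].
  have : agree (mdeg K).+1 (subst uvX (fps_trunc (mdeg K) (c I J))) (part I J phi).
    move=> M hM; rewrite /part h expansion_part //; apply/subr0_eq.
    rewrite -mcoeffB -raddfB; apply: (@ord_subst _ _ _ (mdeg M).+1) => // [i|].
      exact: ord_lin.
    by apply: agree_ord (agree_trunc _); apply: agree_le (agree_trunc _).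
  by move/lam_agree => <- //; rewrite subst_uvXK agree_trunc.
have [I [J [M [d ->]]]] := mjoin_split m; rewrite expansion_part //.
have := @lam_agree (mdeg M).+1 I J phi _ (agree_trunc _) => h1.
transitivity (subst uvX (subst xuv (fps_trunc (mdeg M) (part I J phi))))@_M.
  by rewrite subst_xuvK agree_trunc.
apply/subr0_eq; rewrite -mcoeffB -raddfB.
apply: (@ord_subst _ _ _ (mdeg M).+1) => // [i|]; first exact: ord_lin.
by apply: agree_ord h1 _ => K hK; rewrite agree_trunc // h.
Qed.

End Expansion.

Lemma map_conjc_subst (R : realType) p k (q : 'I_p -> {mpoly R[i][k]}) P :
  map_mpoly conjc (subst q P) = subst (map_mpoly conjc \o q) (map_mpoly conjc P).
Proof.
elim/mpolyind: P => [|c m P _ _ IH]; first by rewrite !raddf0.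
rewrite !raddfD /= IH; congr (_ + _).
rewrite substZ !map_mpolyZ map_mpolyX substZ !substXm rmorph_prod /=; congr (_ *: _).
by apply: eq_bigr => i _; rewrite rmorphXn.
Qed.

Lemma mdeg_e1 n : (0 < n)%N -> mdeg (e1 n) = 1%N.
Proof.
move=> n0; rewrite mdegE (bigD1 (Ordinal n0)) //= mnmE eqxx big1 // => i ne.
by rewrite mnmE; case: eqP => // e; case/eqP: ne; apply: val_inj.
Qed.

(** * Linearity of the expansion coefficients, weights, and restriction to the quadric *)

Section Lam.
Context (R : realType) (n : nat).
Local Notation C := R[i].
Implicit Types (phi psi : fps R (n + n)) (I J K M : 'X_{1..n}) (f g : {mpoly C[n + n]}).

Definition cof p (f : {mpoly C[p]}) : fps R p := fun m => f@_m.

Lemma lam_local phi psi I J K :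
  (forall m, (mdeg m <= mdeg I + mdeg J + (mdeg K).*2)%N -> phi m = psi m) ->
  lam phi I J K = lam psi I J K.
Proof.
move=> h; rewrite /lam; congr (mcoeff _ (subst _ _)).
apply/mpolyP => M; rewrite !fps_truncE; case: leqP => // hM.
by apply: h; rewrite mdegD !mdeg_mjoin -addnn; lia.
Qed.

Lemma lam_lin a phi psi I J K :
  lam (fun m => a * phi m + psi m) I J K = a * lam phi I J K + lam psi I J K.
Proof.
rewrite /lam -mcoeffZ -mcoeffD -substZ -raddfD; congr (mcoeff _ (subst _ _)).
by apply/mpolyP => M; rewrite mcoeffD mcoeffZ !fps_truncE; case: ifP; rewrite ?mulr0 ?addr0.
Qed.

Lemma lam0 I J K : lam (cof 0) I J K = 0.
Proof.
rewrite /lam (_ : fps_trunc _ _ = 0) ?raddf0 ?mcoeff0 //.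
by apply/mpolyP => M; rewrite fps_truncE /part /cof !mcoeff0 if_same.
Qed.

Lemma lamZD a f g I J K : lam (cof (a *: f + g)) I J K = a * lam (cof f) I J K + lam (cof g) I J K.
Proof. by rewrite -lam_lin; apply: lam_local => m _; rewrite /cof mcoeffD mcoeffZ. Qed.

Lemma lamD f g I J K : lam (cof (f + g)) I J K = lam (cof f) I J K + lam (cof g) I J K.
Proof. by rewrite -[f]scale1r lamZD mul1r scale1r. Qed.

Lemma lamZ a f I J K : lam (cof (a *: f)) I J K = a * lam (cof f) I J K.
Proof. by rewrite -[a *: f]addr0 lamZD lam0 addr0. Qed.

Lemma lamB f g I J K : lam (cof (f - g)) I J K = lam (cof f) I J K - lam (cof g) I J K.
Proof. by rewrite lamD -scaleN1r lamZ mulN1r. Qed.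

Lemma lam_sum T (r : seq T) (P : pred T) (F : T -> {mpoly C[n + n]}) I J K :
  lam (cof (\sum_(x <- r | P x) F x)) I J K = \sum_(x <- r | P x) lam (cof (F x)) I J K.
Proof. by elim/big_rec2: _ => [|x y f _ <-]; rewrite ?lam0 ?lamD. Qed.

Lemma lam_conj phi I J K : lam (fps_conj phi) I J K = conjc (lam phi J I K).
Proof.
rewrite /lam -mcoeff_map_mpoly map_conjc_subst.
rewrite (eq_subst _ (@map_conjc_xuv R n)); congr (mcoeff _ (subst _ _)).
apply/mpolyP => M; rewrite mcoeff_map_mpoly !fps_truncE.
case: ifP => _; last by rewrite raddf0.
by rewrite /part /fps_conj -/(mswap _) mjoinD mswap_mjoin -mjoinD.
Qed.

Lemma lam_cj f I J K : lam (cof (cj f)) I J K = conjc (lam (cof f) J I K).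
Proof. by rewrite -lam_conj; apply: lam_local => m _; rewrite /cof cjE. Qed.

Lemma lam_sqn I J K I' J' (P : {mpoly C[n]}) : disjm I J -> disjm I' J' ->
  lam (cof ('X_[mjoin I' J'] * sqn P)) I J K =
  if (I' == I) && (J' == J) then (subst (@xuv R n) P)@_K else 0.
Proof.
move=> d d'; set c := _ && _.
have : agree (mdeg K).+1 (if c then P else 0) (part I J (cof ('X_[mjoin I' J'] * sqn P))).
  by move=> M _; rewrite /part /cof mcoeff_sqn // -/c; case: c; rewrite ?mcoeff0.
by move/lam_agree => <- //; case: c => //; rewrite raddf0 mcoeff0.
Qed.

Lemma lam_basis a I J K I' J' K' : disjm I J -> disjm I' J' ->
  lam (cof (a *: basis_term R I' J' K')) I J K =
  if [&& I' == I, J' == J & K' == K] then a else 0.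
Proof.
move=> d d'; rewrite lamZ basis_termE lam_sqn // subst_uvXK mcoeffX.
by case: (_ == I); case: (_ == J); case: (_ == K); rewrite ?mulr0 ?mulr1.
Qed.

Lemma lam_inj d phi psi :
  (forall I J K, disjm I J -> (mdeg I + mdeg J + (mdeg K).*2 <= d)%N ->
     lam phi I J K = lam psi I J K) ->
  forall m, (mdeg m <= d)%N -> phi m = psi m.
Proof.
move=> h m; have [I [J [M [dIJ ->]]]] := mjoin_split m.
rewrite mdegD !mdeg_mjoin addnn => hM.
have e phi0 : is_expansion phi0 (lam phi0) by apply/is_expansionP.
rewrite (e phi) (e psi) !expansion_part //; congr (mcoeff _ (subst _ _)).
apply/mpolyP => K; rewrite !fps_truncE; case: leqP => // hK; apply: h => //.
by rewrite -!addnn in hM *; lia.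
Qed.

Definition quad : {mpoly C[n + n]} := \sum_(l < n) sqnorm R l.

Lemma cj_quad : cj quad = quad.
Proof.
rewrite /quad raddf_sum /=; apply: eq_bigr => l _.
by rewrite cjM !cjX swap_varL swap_varR mulrC.
Qed.

Lemma ord_sqnorm l : ord 2 (sqnorm R l : {mpoly C[n + n]}).
Proof. by apply: (@ordM _ _ 1 1); apply: ordX. Qed.

Lemma ord_quad : ord 2 quad.
Proof. by apply: ord_sum => l _; apply: ord_sqnorm. Qed.

Lemma ord_basis I J K : ord (mdeg I + mdeg J + (mdeg K).*2) (basis_term R I J K).
Proof.
rewrite basis_termE; apply: ordM; first by rewrite -mdeg_mjoin; apply: ordXm.
rewrite -mul2n substXm /sqn rmorph_prod /=.
suff : rel (2 * mdeg K) 0 (\prod_i subst (@sqnorm R n) (uvX R i ^+ K i))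
                       (\prod_i subst (@sqnorm R n) (uvX R i ^+ K i)) by case.
rewrite mdegE big_distrr /=; apply: rel_prod => l; rewrite rmorphXn /=.
apply/relX/rel_refl; rewrite /uvX /lin raddf_sum /=; apply: ord_sum => j _.
by rewrite substZ substX; apply/ordZ/ord_sqnorm.
Qed.

(* The weight of z_j is 1 and that of w is 2, so that z |-> (z, |z|^2) turns
   weight into degree. *)
Definition wt : 'I_(n + 1) -> nat := pairv (fun=> 1%N) (fun=> 2%N).
Definition mwt (m : 'X_{1..n + 1}) : nat := (\sum_i wt i * m i)%N.

Definition wtord s (G : {mpoly C[n + 1]}) : Prop :=
  forall m, (mwt m < s)%N -> G@_m = 0.

Definition graphv (P : {mpoly C[n + n]}) : 'I_(n + 1) -> {mpoly C[n + n]} :=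
  pairv (fun j => 'X_(lshift n j)) (fun=> P).

Definition mzw I k : 'X_{1..n + 1} := [multinom pairv I (fun=> k) i | i < n + 1].

(** Restriction of a holomorphic polynomial to the graph w = P. *)
Definition res P : {mpoly C[n + 1]} -> {mpoly C[n + n]} := subst (graphv P).

Lemma resD P : {morph res P : G G' / G + G'}.
Proof. exact: raddfD. Qed.

Lemma resZ P a G : res P (a *: G) = a *: res P G.
Proof. exact: substZ. Qed.

Lemma resB P : {morph res P : G G' / G - G'}.
Proof. exact: raddfB. Qed.

Lemma resX P k : {morph res P : G / G ^+ k}.
Proof. exact: rmorphXn. Qed.

Lemma res0 P : res P 0 = 0.
Proof. exact: raddf0. Qed.

Lemma mzwP (m : 'X_{1..n + 1}) :
  m = mzw [multinom m (lshift 1 l) | l < n] (m (rshift n ord0)).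
Proof.
apply/mnmP => i; rewrite mnmE; apply: pairvP => j; first by rewrite mnmE.
by rewrite ord1.
Qed.

Lemma mwt_mzw I k : mwt (mzw I k) = (mdeg I + 2 * k)%N.
Proof.
rewrite /mwt big_split_ord /= big_ord1 mnmE /wt !pairvR mdegE; congr addn.
by apply: eq_bigr => l _; rewrite mnmE !pairvL mul1n.
Qed.

Lemma mdeg_le_mwt m : (mdeg m <= mwt m)%N.
Proof.
rewrite mdegE; apply: leq_sum => i _.
by case: (split_ordP i) => j ->; rewrite /wt ?(pairvL, pairvR) ?leq_pmull.
Qed.

Lemma wtord_0 s : wtord s 0. Proof. by move=> m _; rewrite mcoeff0. Qed.

Lemma wtord_le s t G : (t <= s)%N -> wtord s G -> wtord t G.
Proof. by move=> le h m hm; apply/h/leq_trans/le. Qed.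

Lemma wtordD s G G' : wtord s G -> wtord s G' -> wtord s (G + G').
Proof. by move=> h h' m hm; rewrite mcoeffD h // h' // addr0. Qed.

Lemma wtordN s G : wtord s G -> wtord s (- G).
Proof. by move=> h m hm; rewrite mcoeffN h // oppr0. Qed.

Lemma wtordB s G G' : wtord s G -> wtord s G' -> wtord s (G - G').
Proof. by move=> h h'; apply/wtordD/wtordN. Qed.

Lemma wtordZ s a G : wtord s G -> wtord s (a *: G).
Proof. by move=> h m hm; rewrite mcoeffZ h // mulr0. Qed.

Lemma wtordX I k : wtord (mdeg I + 2 * k) 'X_[mzw I k].
Proof.
by move=> m; rewrite -mwt_mzw mcoeffX; case: eqP => // ->; rewrite ltnn.
Qed.

(** Mostly applied with P' = |z|^2 and D = 1: restrictions to M and to the quadric differ only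
    beyond the leading degree. *)
Lemma res_rel s D P P' G :
  rel 2 D P P' -> wtord s G -> rel s D (res P G) (res P' G).
Proof.
move=> hP hG; apply: (rel_subst (w := wt)) => [i|m ne]; last first.
  by case: leqP => // h; rewrite hG ?eqxx // in ne.
case: (split_ordP i) => j ->; rewrite /graphv /wt !(pairvL, pairvR) //.
exact/rel_refl/ordX.
Qed.

Lemma ord_res s P G : ord 2 P -> wtord s G -> ord s (res P G).
Proof. by move=> hP hG; case: (@res_rel s 0 P P G) => //; apply: rel_refl. Qed.

Lemma res_congr s P P' G : ord s (P - P') -> ord s (res P G - res P' G).
Proof.
move=> h; apply: ord_subst_congr => i.
case: (split_ordP i) => j ->; rewrite /graphv !(pairvL, pairvR) //.
by rewrite subrr; apply: ord_0.
Qed.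

Lemma res_mzw P I k : res P 'X_[mzw I k] = 'X_[mjoin I 0] * P ^+ k.
Proof.
rewrite /res substXm big_split_ord /= big_ord1 mnmE /graphv !pairvR; congr (_ * _).
rewrite [RHS]mpolyXE_id big_split_ord /= [X in _ * X]big1 ?mulr1.
  by apply: eq_bigr => l _; rewrite mjoinL mnmE !pairvL.
by move=> l _; rewrite mjoinR mnm0E.
Qed.

Lemma disjm0r I : disjm I 0.
Proof. by apply/disjmP => l; right; rewrite mnm0E. Qed.

Lemma disjm0l I : disjm 0 I.
Proof. by rewrite disjmC disjm0r. Qed.

Context (n_gt0 : (0 < n)%N).

Lemma quad_uv : quad = uv R (Ordinal n_gt0).
Proof. by rewrite /uv. Qed.

Lemma subst_uvX_e1 k :
  sqn (subst (@uvX R n) 'X_[e1 n *+ k]) = quad ^+ k.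
Proof.
rewrite substXm (bigD1 (Ordinal n_gt0)) //= big1 ?mulr1 => [|l ne].
  by rewrite /sqn rmorphXn /= -/(sqn _) -uvE -quad_uv mulmnE mnmE eqxx mul1n.
rewrite mulmnE mnmE; case: eqP => // e; case/eqP: ne; exact: val_inj.
Qed.

Lemma res_basis I k : res quad 'X_[mzw I k] = basis_term R I 0 (e1 n *+ k).
Proof. by rewrite res_mzw basis_termE subst_uvX_e1. Qed.

(** On the quadric w = u, so z^I w^k becomes the basis term of index (I, 0, k e_1), and the
    coefficients of G are read off the expansion. *)
Lemma lam_res G I J K : disjm I J ->
  lam (cof (res quad G)) I J K =
  if (J == 0%MM) && (K == (e1 n *+ mdeg K)%MM) then G@_(mzw I (mdeg K)) else 0.
Proof.
move=> d; elim/mpolyind: G => [|a m G _ _ IH].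
  by rewrite /res raddf0 lam0 mcoeff0 if_same.
rewrite {1}/res raddfD /= lamD -[lam (cof (subst _ G)) _ _ _]/(lam (cof (res quad G)) I J K) {}IH.
rewrite substZ [m]mzwP -/(res _ _) res_basis lam_basis ?disjm0r //.
rewrite mcoeffD mcoeffZ mcoeffX [0%MM == J]eq_sym.
set I' := [multinom _ | _ < _]; set k := m _.
case: (J == 0%MM); rewrite ?andbF ?addr0 //= ?andbT.
case: (K =P _) => [e|ne].
  have -> : (mzw I' k == mzw I (mdeg K)) = (I' == I) && ((e1 n *+ k)%MM == K).
    apply/eqP/andP => [/mnmP h|[/eqP -> /eqP <-]]; last by rewrite mdegMn mdeg_e1 // mul1n.
    split; apply/eqP.
      by apply/mnmP => l; have := h (lshift 1 l); rewrite !mnmE !pairvL => <-; rewrite mnmE.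
    by have := h (rshift n ord0); rewrite !mnmE !pairvR => ->.
  by case: andP => _; rewrite ?mulr1 ?mulr0.
rewrite addr0; case: (_ =P K) => [h|]; last by rewrite andbF.
by case: ne; rewrite -h mdegMn mdeg_e1 // mul1n.
Qed.

End Lam.

(** * The homological equation *)

Section Homological.
Context (R : realType) (n : nat) (n_gt0 : (0 < n)%N).
Local Notation C := R[i].
Implicit Types (I J K M : 'X_{1..n}) (f g e : {mpoly C[n + n]}).
Let o1 : 'I_n := Ordinal n_gt0.

Lemma e1E : e1 n = U_(o1)%MM.
Proof. by apply/mnmP => i; rewrite !mnmE eq_sym -val_eqE. Qed.

Lemma normalizedD f g : normalized (lam (cof f)) -> normalized (lam (cof g)) ->
  normalized (lam (cof (f + g))).
Proof.
have ReD (x y : C) : complex.Re (x + y) = complex.Re x + complex.Re y.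
  by case: x y => [? ?] [? ?].
move=> [f1 f2 f3 f4 [f5 f6]] [g1 g2 g3 g4 [g5 g6]].
split=> [t ht|l i hl hi|l i j hl hij|I hI|]; rewrite ?lamD.
- by rewrite f1 // g1 // addr0.
- by rewrite ReD f2 // g2 // addr0.
- by rewrite f3 // g3 // addr0.
- have [a1 a2 a3] := f4 I hI; have [b1 b2 b3] := g4 I hI.
  by split=> [l hl|l hl|k j hj]; rewrite lamD ?a1 ?a2 ?a3 ?b1 ?b2 ?b3 ?addr0.
- split=> [k h I hI hh|I hI]; rewrite !lamD.
    by rewrite f5 // g5 // addr0.
  by rewrite f6 // g6 // conjcD.
Qed.

Lemma normalized0 : normalized (lam (cof (0 : {mpoly C[n + n]}))).
Proof.
split=> [t ht|l i hl hi|l i j hl hij|I hI|]; rewrite ?lam0 //.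
- by split=> *; rewrite lam0.
- by split=> *; rewrite !lam0 // raddf0.
Qed.

(** The hypotheses exclude every index that a normalization constrains; their negations are the five
    exceptional cases of [solvable_basis]. *)
Lemma normalized_basis (a : C) I J K : disjm I J ->
  (J = 0%MM -> forall k, K <> (e1 n *+ k)%MM) ->
  (I = 0%MM -> J = 0%MM -> forall k (i : 'I_n), (0 < i)%N -> K <> (e1 n *+ k + U_(i))%MM) ->
  (I = 0%MM -> J <> 0%MM -> forall k j, K <> (e1 n *+ k + U_(j))%MM) ->
  (I = 0%MM -> J <> 0%MM -> K <> 0%MM) ->
  (forall h k, J = U_(h)%MM -> K = (e1 n *+ k)%MM -> I h = 0%N ->
     ~ ((2 <= mdeg I)%N \/ (exists2 i : 'I_n, (h < i)%N & I = U_(i)%MM))) ->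
  normalized (lam (cof (a *: basis_term R I J K))).
Proof.
move=> d h1 h2 h3 h4 h5.
have z I' J' K' : disjm I' J' -> (I = I' -> J = J' -> K = K' -> False) ->
    lam (cof (a *: basis_term R I J K)) I' J' K' = 0.
  by move=> d' h; rewrite lam_basis //; case: and3P => // -[/eqP ? /eqP ? /eqP ?]; case: h.
have nz I' : (1 <= mdeg I')%N -> I' <> 0%MM by move=> h e; rewrite e mdeg0 in h.
split=> [t ht|l i hl hi|l i j hl hij|I' hI|].
- by apply: z => [|_ eJ eK]; [exact: disjm0l | exact: (h1 eJ t)].
- by rewrite z => [||eI eJ eK]; [|exact: disjm0l | exact: (h2 eI eJ l i hi)].
- have ij : (i == j) = false by apply/eqP => e; rewrite e ltnn in hij.
  apply: z => [|eI eJ eK].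
    apply/disjmP => x; rewrite !mnm1E; case: eqP => [<-|]; last by left.
    by right; rewrite eq_sym ij.
  by apply: (h5 j l eJ eK); [rewrite eI mnm1E ij | right; exists i].
- split=> [l hl|l hl|k j hj].
  + by apply: z => [|_ eJ eK]; [exact: disjm0r | exact: (h1 eJ l)].
  + apply: z => [|eI eJ eK]; first exact: disjm0l.
    apply: (h3 eI _ l.-1 o1); first by rewrite eJ; apply: nz.
    by rewrite -e1E -mulmSr prednK.
  + apply: z => [|eI eJ eK]; first exact: disjm0l.
    by apply: (h3 eI _ k j) => //; rewrite eJ; apply: nz.
- split=> [k h I' hI hh|I' hI].
    apply: z => [|eI eJ eK]; last by apply: (h5 h k eJ eK); rewrite eI //; left.
    by apply/disjmP => x; rewrite mnm1E; case: eqP => [<-|]; [left|right].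
  have I0 : I' <> 0%MM by apply: nz; lia.
  rewrite z => [||eI eJ eK]; [|exact: disjm0l|by apply: (h4 eI) => //; rewrite eJ].
  by rewrite z ?raddf0 // => [|_ eJ eK]; [exact: disjm0r|apply: (h1 eJ 0%N)].
Qed.

Lemma cj_uv (k : 'I_n) : cj (uv R k) = uv R k.
Proof.
have cs l : cj (sqnorm R l) = sqnorm R l :> {mpoly C[n + n]}.
  by rewrite cjM !cjX swap_varL swap_varR mulrC.
rewrite /uv; case: ifP => _; last rewrite cjB cs; rewrite raddf_sum /=.
  by apply: eq_bigr => l _; rewrite cs.
by congr (_ - _); apply: eq_bigr => l _; rewrite cs.
Qed.

Lemma cj_basis I J K : cj (basis_term R I J K) = basis_term R J I K.
Proof.
rewrite /basis_term !cjM !rmorph_prod /= [X in X * _]mulrC; congr (_ * _ * _).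
- by apply: eq_bigr => l _; rewrite rmorphXn /= cjX swap_varR.
- by apply: eq_bigr => l _; rewrite rmorphXn /= cjX swap_varL.
- by apply: eq_bigr => l _; rewrite rmorphXn /= cj_uv.
Qed.

Lemma uv_sum (k : 'I_n) : uv R k = \sum_l uv_mx R n k l *: sqnorm R l.
Proof.
by rewrite uvE /sqn /uvX /lin raddf_sum /=; apply: eq_bigr => l _; rewrite substZ substX.
Qed.

Lemma mul_zbar_res (h : 'I_n) I k :
  'X_(rshift n h) * res (quad R n) 'X_[mzw I k] = basis_term R I U_(h) (e1 n *+ k).
Proof.
rewrite (res_basis R n_gt0) !basis_termE mulrA -mpolyXD; congr ('X_[_] * _).
apply: mjoinP => l; rewrite mnmDE mnm1E !(mjoinL, mjoinR) ?mnm0E ?mnm1E ?addn0.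
  by rewrite eq_rlshift.
by rewrite eq_rshift.
Qed.

(** With f_l = z_l z^J w^k weighted by row j of [uv_mx], the pairing with z is a multiple of z^J u^k
    v_j: a change of z alone reaches the terms linear in v_j. *)
Lemma sum_zbar_res (a : C) (j : 'I_n) J k :
  \sum_l 'X_(rshift n l) *
    res (quad R n) ((a * uv_mx R n j l) *: 'X_[mzw (J + U_(l)) k]) =
  a *: basis_term R J 0 (e1 n *+ k + U_(j)).
Proof.
have -> : basis_term R J 0 (e1 n *+ k + U_(j)) = 'X_[mjoin J 0] * quad R n ^+ k * uv R j.
  rewrite basis_termE -mulrA mpolyXD rmorphM /= substX; congr (_ * _).
  by rewrite /sqn rmorphM /= -/(sqn _) -/(sqn (uvX R j)) (subst_uvX_e1 R n_gt0) -uvE.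
rewrite uv_sum mulr_sumr scaler_sumr; apply: eq_bigr => l _.
rewrite /res substZ -/(res _ _) res_mzw -!scalerAr scalerA; congr (_ *: _).
have -> : mjoin (J + U_(l)) 0 = (mjoin J 0 + U_(lshift n l))%MM.
  apply/esym/mjoinP => i; rewrite mnmDE !(mjoinL, mjoinR) mnm1E ?mnmDE ?mnm1E.
    by rewrite eq_lshift.
  by rewrite eq_lrshift addn0.
by rewrite mpolyXD /sqnorm; ring.
Qed.

(** The Hermitian pairing <f, z> on the quadric. *)
Definition zbar_pair (df : 'I_n -> {mpoly C[n + 1]}) : {mpoly C[n + n]} :=
  \sum_l 'X_(rshift n l) * res (quad R n) (df l).

(* The first-order effect on |z|^2 + phi of z' = z + df, w' = w + dg. *)
Definition hop df dg : {mpoly C[n + n]} :=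
  res (quad R n) dg - (zbar_pair df + cj (zbar_pair df)).

Lemma hopD df dg df' dg' :
  hop (fun l => df l + df' l) (dg + dg') = hop df dg + hop df' dg'.
Proof.
rewrite /hop {1}/res raddfD /= -!/(res _ _).
have -> : zbar_pair (fun l => df l + df' l) = zbar_pair df + zbar_pair df'.
  by rewrite -big_split; apply: eq_bigr => l _; rewrite /res raddfD mulrDr.
by rewrite cjD; ring.
Qed.

Lemma hop0l dg : hop (fun=> 0) dg = res (quad R n) dg.
Proof.
rewrite /hop [zbar_pair _]big1 ?cj0 ?addr0 ?subr0 // => l _.
by rewrite /res raddf0 mulr0.
Qed.

Lemma hop0r df : hop df 0 = - (zbar_pair df + cj (zbar_pair df)).
Proof. by rewrite /hop /res raddf0 add0r. Qed.

(** A correction (f, g) normalizes the degree D part of e. The f have weight one less because each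
    is multiplied by some zbar_l. Additivity in e reduces the question to single basis terms. *)
Definition solvable D e : Prop := exists df dg psi,
  [/\ forall l, wtord D.-1 (df l), wtord D dg, ord D psi,
      normalized (lam (cof psi)) & ord D.+1 (e + hop df dg - psi)].

Lemma solvable_congr D e e' : ord D.+1 (e - e') -> solvable D e' -> solvable D e.
Proof.
move=> h [df [dg [psi [h1 h2 h3 h4 h5]]]]; exists df, dg, psi; split=> //.
by have := ordD h h5; rewrite addrA [_ + (e' + _)]addrA subrK.
Qed.

Lemma solvable_normal D e : ord D e -> normalized (lam (cof e)) -> solvable D e.
Proof.
move=> h1 h2; exists (fun=> 0), 0, e; split=> // [_||]; [exact: wtord_0|exact: wtord_0|].
by rewrite hop0l /res raddf0 addr0 subrr; apply: ord_0.
Qed.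

Lemma solvableD D e e' : solvable D e -> solvable D e' -> solvable D (e + e').
Proof.
move=> [df [dg [psi [h1 h2 h3 h4 h5]]]] [df' [dg' [psi' [g1 g2 g3 g4 g5]]]].
exists (fun l => df l + df' l), (dg + dg'), (psi + psi'); split.
- by move=> l; apply: wtordD.
- exact: wtordD.
- exact: ordD.
- exact: normalizedD.
- have := ordD h5 g5; congr ord; rewrite hopD; ring.
Qed.

Lemma solvable0 D : solvable D 0.
Proof. by apply: solvable_normal; [exact: ord_0 | exact: normalized0]. Qed.

Lemma solvable_hop D df dg e : (forall l, wtord D.-1 (df l)) -> wtord D dg ->
  solvable D (e + hop df dg) -> solvable D e.
Proof.
move=> g1 g2 [df' [dg' [psi [h1 h2 h3 h4 h5]]]].
exists (fun l => df l + df' l), (dg + dg'), psi; split=> //.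
- by move=> l; apply: wtordD.
- exact: wtordD.
- by rewrite hopD addrA.
Qed.

Lemma solvable_holomorphic D (a : C) I k : (mdeg I + 2 * k = D)%N ->
  solvable D (a *: basis_term R I 0 (e1 n *+ k)).
Proof.
move=> hD; apply: (@solvable_hop D (fun=> 0) ((- a) *: 'X_[mzw I k])).
- by move=> _; exact: wtord_0.
- by rewrite -hD; apply: wtordZ; exact: wtordX.
rewrite hop0l /res substZ -/(res _ _) (res_basis R n_gt0) scaleNr subrr.
exact: solvable0.
Qed.

Lemma mdeg_e1k k : mdeg (e1 n *+ k)%MM = k.
Proof. by rewrite mdegMn mdeg_e1 // mul1n. Qed.

(** Since 2 Re <f, z> is real, only the real part of the coefficient can be removed, which is what
    the normalization asks. *)
Lemma solvable_real D (a : C) k (i : 'I_n) : (0 < i)%N -> (2 * k.+1 = D)%N ->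
  solvable D (a *: basis_term R 0 0 (e1 n *+ k + U_(i))).
Proof.
(* Half of a, because the pairing and its conjugate contribute to the same basis term; the remaining
   coefficient is a - Re a. *)
move=> hi hD; pose df l := ((a / 2%:R) * uv_mx R n i l) *: 'X_[mzw (0 + U_(l)) k].
apply: (@solvable_hop D df 0).
- move=> l; apply: wtordZ; apply: (wtord_le _ (@wtordX R n _ _)).
  by rewrite add0m mdeg1; lia.
- exact: wtord_0.
have hK : mdeg (e1 n *+ k + U_(i))%MM = k.+1 by rewrite mdegD mdeg_e1k mdeg1 addn1.
rewrite hop0r /zbar_pair sum_zbar_res cjZ cj_basis -scalerDl -scalerBl.
set b := a - _.
have Reb : complex.Re b = 0.
  have : conjc b = - b.
    have h2 : 2%:R * (2%:R)^-1 = 1 :> C by rewrite divff // pnatr_eq0.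
    rewrite /b conjcB conjcD conjcK; set x := a / _.
    have -> : a = x + x by rewrite /x -mulrDr -[X in _ * (X + X)]mul1r -mulrDl h2 mulr1.
    by rewrite conjcD; ring.
  case: b => [x y] /eqP; rewrite eq_complex /= => /andP [e _]; apply/eqP; move: e.
  by rewrite -subr_eq0 opprK -mulr2n mulrn_eq0.
apply: solvable_normal.
  by apply: ordZ; apply: (ord_le _ (@ord_basis R n _ _ _)); rewrite mdeg0 hK -addnn; lia.
have ne k' : (e1 n *+ k + U_(i) <> e1 n *+ k')%MM.
  move=> e; have := congr1 (fun m : 'X_{1..n} => m i) e.
  by rewrite mnmDE !mulmnE !mnmE eqxx; case: eqP => [h|_]; [rewrite h in hi|lia].
have z I' J' K' : disjm I' J' ->
    (0%MM = I' -> 0%MM = J' -> (e1 n *+ k + U_(i) = K')%MM -> False) ->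
    lam (cof (b *: basis_term R 0 0 (e1 n *+ k + U_(i)))) I' J' K' = 0.
  move=> d' h; rewrite lam_basis ?disjm0l //.
  by case: and3P => // -[/eqP ? /eqP ? /eqP ?]; case: h.
have nz I' : (1 <= mdeg I')%N -> 0%MM <> I' by move=> h e; rewrite -e mdeg0 in h.
split=> [t ht|l j hl hj|l i' j hl hij|I' hI|].
- by apply: z => [|_ _ e]; [exact: disjm0l | exact: (ne _ e)].
- by rewrite lam_basis ?disjm0l //; case: ifP.
- apply: z => [|e]; last by case/eqP: (negbT (mnm1_eq0 i')).
  apply/disjmP => x; rewrite !mnm1E; case: eqP => [<-|]; last by left.
  by right; case: eqP => // e; rewrite e ltnn in hij.
- split=> *; apply: z; rewrite ?disjm0r ?disjm0l // => e1 e2 e3.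
  + exact: (nz _ hI).
  + exact: (nz _ hI).
  + exact: (nz _ hI).
- split=> [k' h I' hI hh|I' hI].
    apply: z => [|e _ _]; last by apply: (nz I' _ e); lia.
    by apply/disjmP => x; rewrite mnm1E; case: eqP => [<-|]; [left|right].
  have nI : 0%MM <> I' by apply: nz; lia.
  by rewrite !z ?raddf0 ?disjm0l ?disjm0r.
Qed.

(** The conjugate of the pairing cancels the term, and the pairing itself leaves a multiple of z^J
    u^k v_j. For the first j this is z^J u^(k+1), absorbed by a change of w; for the others it is
    unconstrained. *)
Lemma solvable_antiholomorphic D (a : C) J k (j : 'I_n) : J <> 0%MM ->
  (mdeg J + 2 * k.+1 = D)%N ->
  solvable D (a *: basis_term R 0 J (e1 n *+ k + U_(j))).
Proof.
move=> hJ hD; pose df l := (conjc a * uv_mx R n j l) *: 'X_[mzw (J + U_(l)) k].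
have hK : mdeg (e1 n *+ k + U_(j))%MM = k.+1 by rewrite mdegD mdeg_e1k mdeg1 addn1.
apply: (@solvable_hop D df 0).
- move=> l; apply: wtordZ; apply: (wtord_le _ (@wtordX R n _ _)).
  by rewrite mdegD mdeg1; lia.
- exact: wtord_0.
rewrite hop0r /zbar_pair sum_zbar_res cjZ cj_basis conjcK opprD addrA addrAC subrr sub0r.
rewrite -scaleNr; case: (posnP j) => hj.
  have -> : (e1 n *+ k + U_(j) = e1 n *+ k.+1)%MM.
    by rewrite mulmSr e1E; congr (_ + U_(_))%MM; apply: val_inj.
  exact: solvable_holomorphic.
apply: solvable_normal.
  by apply: ordZ; apply: (ord_le _ (@ord_basis R n _ _ _)); rewrite mdeg0 hK -addnn; lia.
apply: normalized_basis => //; first exact: disjm0r.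
- move=> _ k' e; have := congr1 (fun m : 'X_{1..n} => m j) e.
  by rewrite mnmDE !mulmnE !mnmE eqxx; case: eqP => [h|_]; [rewrite h in hj|lia].
- by move=> h k' e; case/eqP: (negbT (mnm1_eq0 h)).
Qed.

(** A change of z_h trades the term for its conjugate, of index (e_h, I, k e_1). That index is free:
    either |I| >= 2, or I = e_i with h < i, the unconstrained order of two unit vectors. *)
Lemma solvable_conj_linear D (a : C) I h k : I h = 0%N -> I <> 0%MM ->
  (mdeg I + 1 + 2 * k = D)%N ->
  (2 <= mdeg I)%N \/ (exists2 i : 'I_n, (h < i)%N & I = U_(i)%MM) ->
  solvable D (a *: basis_term R I U_(h) (e1 n *+ k)).
Proof.
move=> hI nI hD hI'.
pose df l := if l == h then a *: 'X_[mzw I k] else 0.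
apply: (@solvable_hop D df 0).
- move=> l; rewrite /df; case: eqP => _; last exact: wtord_0.
  by apply: wtordZ; apply: (wtord_le _ (@wtordX R n _ _)); lia.
- exact: wtord_0.
have -> : hop df 0 = - (a *: basis_term R I U_(h) (e1 n *+ k) +
                        conjc a *: basis_term R U_(h) I (e1 n *+ k)).
  rewrite hop0r; suff -> : zbar_pair df = a *: basis_term R I U_(h) (e1 n *+ k).
    by rewrite cjZ cj_basis.
  rewrite /zbar_pair (bigD1 h) //= big1 ?addr0 => [|l /negbTE ne].
    by rewrite /df eqxx /res substZ -/(res _ _) -scalerAr mul_zbar_res.
  by rewrite /df ne /res raddf0 mulr0.
rewrite opprD addrA subrr sub0r -scaleNr; apply: solvable_normal.
  apply: ordZ; apply: (ord_le _ (@ord_basis R n _ _ _)).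
  by rewrite mdeg1 mdeg_e1k -addnn; lia.
apply: normalized_basis => //.
- by apply/disjmP => x; rewrite mnm1E; case: eqP => [<-|]; [right|left].
- by move=> /eqP; rewrite mnm1_eq0.
- by move=> /eqP; rewrite mnm1_eq0.
- move=> h' k' eI _ _; rewrite mdeg1; case=> // -[i hi /eqP]; rewrite eq_mnm1 => /eqP e.
  case: hI' => [|[i' hi' e']]; first by rewrite eI mdeg1.
  by move: eI; rewrite e' => /eqP; rewrite eq_mnm1 => /eqP e2; move: hi hi'; rewrite e e2; lia.
Qed.

(** Adding conj a z^J produces a conjugate pair, as the normalization requires; the compensating
    term is holomorphic and is absorbed by a change of w. *)
Lemma solvable_pure D (a : C) J : (mdeg J = D)%N -> (2 < D)%N ->
  solvable D (a *: basis_term R 0 J 0).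
Proof.
move=> hJ hD.
have -> : a *: basis_term R 0 J 0 =
  (a *: basis_term R 0 J 0 + conjc a *: basis_term R J 0 0)
  + (- conjc a) *: basis_term R J 0 (e1 n *+ 0).
  by rewrite mulm0n scaleNr addrK.
apply: solvableD; last by apply: solvable_holomorphic; lia.
apply: solvable_normal.
  by apply: ordD; apply: ordZ; apply: (ord_le _ (@ord_basis R n _ _ _)); rewrite !mdeg0; lia.
have L I' J' K' : disjm I' J' ->
    lam (cof (a *: basis_term R 0 J 0 + conjc a *: basis_term R J 0 0)) I' J' K' =
    (if [&& 0%MM == I', J == J' & 0%MM == K'] then a else 0) +
    (if [&& J == I', 0%MM == J' & 0%MM == K'] then conjc a else 0).
  by move=> d; rewrite lamD !lam_basis ?disjm0l ?disjm0r.
have zK l : (1 <= l)%N -> (0%MM == (e1 n *+ l)%MM) = false.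
  by move=> hl; apply/eqP => /(congr1 (@mdeg n)); rewrite mdeg0 mdeg_e1k; lia.
have zK' l i : (0%MM == (e1 n *+ l + U_(i))%MM) = false.
  by apply/eqP => /(congr1 (@mdeg n)); rewrite mdeg0 mdegD mdeg1; lia.
have nz I' : (1 <= mdeg I')%N -> (0%MM == I') = false.
  by move=> h; apply/eqP => e; rewrite -e mdeg0 in h.
have J0 : (0%MM == J) = false by apply: nz; lia.
have J0' : (J == 0%MM) = false by rewrite eq_sym.
split=> [t ht|l j hl hj|l i' j hl hij|I' hI|].
- by rewrite L ?disjm0l // zK ?andbF ?addr0 //; lia.
- by rewrite L ?disjm0l // zK' ?andbF ?addr0.
- rewrite L ?zK ?andbF ?addr0 //.
  apply/disjmP => x; rewrite !mnm1E; case: eqP => [<-|]; last by left.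
  by right; case: eqP => // e; rewrite e ltnn in hij.
- split=> *; rewrite L ?disjm0l ?disjm0r //.
  + by rewrite zK ?andbF ?addr0.
  + by rewrite zK ?andbF ?addr0.
  + by rewrite zK' ?andbF ?addr0.
- split=> [k' h I' hI hh|I' hI].
    rewrite L; last by apply/disjmP => x; rewrite mnm1E; case: eqP => [<-|]; [left|right].
    rewrite nz /=; last by lia.
    by rewrite [0%MM == U_(h)%MM]eq_sym mnm1_eq0 /= andbF add0r.
  have nI : (0%MM == I') = false by apply: nz; lia.
  rewrite (L _ _ _ (disjm0l I')) (L _ _ _ (disjm0r I')) J0' nI !eqxx /= !andbT addr0 add0r.
  by case: ifP => _; rewrite ?conjcK ?raddf0.
Qed.

Lemma solvable_basis D (a : C) I J K : (2 < D)%N -> disjm I J ->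
  (mdeg I + mdeg J + (mdeg K).*2 = D)%N -> solvable D (a *: basis_term R I J K).
Proof.
move=> D3 d; rewrite -mul2n => hD.
have [[J0 [k Kk]]|c1] := EM (J = 0%MM /\ exists k, K = (e1 n *+ k)%MM).
  rewrite J0 Kk; apply: solvable_holomorphic.
  by rewrite -hD J0 Kk mdeg0 mdeg_e1k addn0.
have [[[I0 J0] [k [i hi Ki]]]|c2] := EM ((I = 0%MM /\ J = 0%MM) /\
    exists k, exists2 i : 'I_n, (0 < i)%N & K = (e1 n *+ k + U_(i))%MM).
  rewrite I0 J0 Ki; apply: solvable_real => //.
  by rewrite -hD I0 J0 Ki mdegD mdeg_e1k mdeg1 !mdeg0 addn1.
have [[[I0 J0] [k [j Kj]]]|c3] := EM ((I = 0%MM /\ J <> 0%MM) /\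
    exists k j, K = (e1 n *+ k + U_(j))%MM).
  rewrite I0 Kj; apply: solvable_antiholomorphic => //.
  by rewrite -hD I0 Kj mdegD mdeg_e1k mdeg1 !mdeg0 addn1.
have [[I0 [J0 K0]]|c4] := EM (I = 0%MM /\ J <> 0%MM /\ K = 0%MM).
  by rewrite I0 K0; apply: solvable_pure => //; rewrite -hD I0 K0 !mdeg0 addn0.
have [[h [k [Jh Kk Ih hI]]]|c5] := EM (exists h k,
    [/\ J = U_(h)%MM, K = (e1 n *+ k)%MM, I h = 0%N &
        (2 <= mdeg I)%N \/ (exists2 i : 'I_n, (h < i)%N & I = U_(i)%MM)]).
  rewrite Jh Kk; apply: solvable_conj_linear => //.
    by move=> I0; case: hI => [|[i _ /eqP]]; rewrite I0 ?mdeg0 // eq_sym mnm1_eq0.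
  by rewrite -hD Jh Kk mdeg1 mdeg_e1k.
apply: solvable_normal.
  by apply: ordZ; apply: (ord_le _ (@ord_basis R n _ _ _)); rewrite -mul2n hD.
apply: normalized_basis => //.
- by move=> J0 k Kk; apply: c1; split=> //; exists k.
- by move=> I0 J0 k i hi Ki; apply: c2; split=> //; exists k, i.
- by move=> I0 J0 k j Kj; apply: c3; split=> //; exists k, j.
- by move=> I0 J0 K0; apply: c4.
- by move=> h k Jh Kk Ih hI; apply: c5; exists h, k.
Qed.

Lemma homological_equation D e : (2 < D)%N -> ord D e -> solvable D e.
Proof.
move=> D3 he.
pose cond (I J K : 'X_{1..n < D.+1}) : bool :=
  disjm I J && (mdeg I + mdeg J + (mdeg K).*2 == D)%N.
pose e' := \sum_(I : 'X_{1..n < D.+1}) \sum_(J : 'X_{1..n < D.+1})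
  \sum_(K : 'X_{1..n < D.+1} | cond I J K) lam (cof e) I J K *: basis_term R I J K.
apply: (@solvable_congr D _ e'); last first.
  apply: (big_ind (solvable D)) => [||I _]; [exact: solvable0|exact: solvableD|].
  apply: (big_ind (solvable D)) => [||J _]; [exact: solvable0|exact: solvableD|].
  apply: (big_ind (solvable D)) => [||K /andP [d /eqP h]].
  - exact: solvable0.
  - exact: solvableD.
  - exact: solvable_basis.
(* Both sides have the same expansion coefficients up to degree D; those below D vanish since e has
   order D. *)
suff h m : (mdeg m <= D)%N -> cof e m = cof e' m.
  by move=> m hm; rewrite mcoeffB -/(cof e m) h ?subrr.
move: m; apply: lam_inj => I J K d hIJK; rewrite lam_sum.
have bI : (mdeg I < D.+1)%N by lia.
have bJ : (mdeg J < D.+1)%N by lia.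
have bK : (mdeg K < D.+1)%N by rewrite -addnn in hIJK; lia.
rewrite (bigD1 (BMultinom bI)) //= [X in _ + X]big1 ?addr0; last first.
  move=> I' ne; rewrite lam_sum big1 // => J' _; rewrite lam_sum big1 // => K' /andP [d' _].
  rewrite lam_basis // (_ : (_ == I) = false) //.
  by apply: contraNF ne => /eqP eI; apply/eqP/val_inj.
rewrite lam_sum (bigD1 (BMultinom bJ)) //= [X in _ + X]big1 ?addr0; last first.
  move=> J' ne; rewrite lam_sum big1 // => K' /andP [d' _].
  rewrite lam_basis // (_ : (_ == J) = false) ?andbF //.
  by apply: contraNF ne => /eqP eI; apply/eqP/val_inj.
rewrite lam_sum big_mkcond (bigD1 (BMultinom bK)) //= [X in _ + X]big1 ?addr0; last first.
  move=> K' ne; case: ifP => // /andP [d' _].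
  rewrite lam_basis // (_ : (bmnm K' == K) = false) ?andbF //.
  by apply: contraNF ne => /eqP eI; apply/eqP/val_inj.
rewrite /cond d /=; case: eqP => hD; first by rewrite lam_basis // !eqxx.
rewrite -(lam0 R I J K); apply: lam_local => m hm; rewrite /cof mcoeff0; apply: he.
by apply: leq_ltn_trans hm _; rewrite ltn_neqAle hIJK andbT; apply/eqP.
Qed.

End Homological.

(** * Existence of pseudo-normal forms *)

Lemma dependent_choice (A : Type) (Q : nat -> A -> Prop) (T : nat -> A -> A -> Prop) :
  (exists a, Q 0%N a) -> (forall k a, Q k a -> exists2 b, Q k.+1 b & T k a b) ->
  exists s, forall k, Q k (s k) /\ T k (s k) (s k.+1).
Proof.
move=> h0 hS.
have hS' k (x : {a | Q k a}) : {y : {a | Q k.+1 a} | T k (sval x) (sval y)}.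
  case: x => a ha; have [b hb] := cid2 (hS k a ha).
  by exists (exist _ b hb).
pose s : forall k, {a | Q k a} := nat_rect _ (cid h0) (fun k x => sval (hS' k x)).
exists (fun k => sval (s k)) => k; split; first exact: svalP.
exact: (svalP (hS' k (s k))).
Qed.

Section Graph.
Context (R : realType) (n : nat).
Local Notation C := R[i].
Implicit Types (Phi E : fps R (n + n)) (P : {mpoly C[n + n]}).

(** Whatever replaces z, its conjugate replaces zbar; substitution by such a vector commutes with
    conjugation. *)
Definition cpair (q : 'I_n -> {mpoly C[n + n]}) : 'I_(n + n) -> {mpoly C[n + n]} :=
  pairv q (fun j => cj (q j)).

Lemma cpair_swap q i : cpair q (swap_var i) = cj (cpair q i).
Proof.
by case: (split_ordP i) => j ->; rewrite ?(swap_varL, swap_varR) /cpair !(pairvL, pairvR) ?cjK.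
Qed.

Lemma subst_cpair_quad q : subst (cpair q) (quad R n) = \sum_l q l * cj (q l).
Proof.
rewrite /quad raddf_sum /=; apply: eq_bigr => l _.
by rewrite rmorphM /= !substX /cpair pairvL pairvR.
Qed.

Lemma subst_cpairX f : subst (cpair (fun l => 'X_(lshift n l))) f = f.
Proof.
rewrite -[RHS]subst_id; apply: eq_subst => i.
by case: (split_ordP i) => j ->; rewrite /cpair ?pairvL ?pairvR // cjX swap_varL.
Qed.

Lemma ord_cpair s q : (forall l, ord s (q l)) -> forall i, ord s (cpair q i).
Proof.
by move=> h i; case: (split_ordP i) => j ->; rewrite /cpair ?(pairvL, pairvR) //; apply: ord_cj.
Qed.

Lemma ord_cpairB s q q' : (forall l, ord s (q l - q' l)) ->
  forall i, ord s (cpair q i - cpair q' i).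
Proof.
move=> h i; case: (split_ordP i) => j ->; rewrite /cpair ?(pairvL, pairvR) // -cjB.
exact: ord_cj.
Qed.

Lemma rel_cpair s D q q' : (forall l, rel s D (q l) (q' l)) ->
  forall i, rel s D (cpair q i) (cpair q' i).
Proof.
move=> h i; split; [apply: ord_cpair|apply: ord_cpair|apply: ord_cpairB];
  by move=> l; case: (h l).
Qed.

Lemma quad_E d P E : order_ge3 E -> agree d P (quadric_plus E) -> (3 <= d)%N ->
  ord 3 (P - quad R n).
Proof.
move=> hE hP hd m hm; rewrite mcoeffB hP; last exact: leq_trans hd.
by rewrite /quadric_plus hE // addr0 subrr.
Qed.

Lemma ord2_quad P : ord 3 (P - quad R n) -> ord 2 P.
Proof.
move=> h; rewrite -(subrK (quad R n) P); apply: ordD; last exact: ord_quad.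
exact: (ord_le _ h).
Qed.

Lemma rel_quad P : ord 3 (P - quad R n) -> rel 2 1 P (quad R n).
Proof. by move=> h; split=> //; [exact: ord2_quad | exact: ord_quad]. Qed.

Lemma quadric0 E : order_ge3 E -> quadric_plus E 0%MM = 0.
Proof.
move=> hE; rewrite /quadric_plus hE ?mdeg0 // addr0.
by apply: (@ord_quad R n); rewrite mdeg0.
Qed.

Lemma graph_param0 Phi i : Phi 0%MM = 0 -> graph_param Phi i 0%MM = 0.
Proof.
move=> h; rewrite /graph_param; case: split => // j.
by apply: (@ordX _ _ (lshift n j)); rewrite mdeg0.
Qed.

Lemma agree_graph d P Phi i : agree d P Phi -> agree d (graphv P i) (graph_param Phi i).
Proof. by move=> h m hm; rewrite /graphv /graph_param /pairv; case: split => // _; apply: h. Qed.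

(** The coefficients of F matter by weight rather than by degree, because w restricts to order 2. *)
Lemma agree_res d P Phi G (F : fps R (n + 1)) : Phi 0%MM = 0 -> ord 2 P ->
  agree d P Phi -> (forall m, (mwt m < d)%N -> G@_m = F m) ->
  agree d (res P G) (fps_comp F (graph_param Phi)).
Proof.
move=> Phi0 P2 hP hG.
have h := @agree_comp R _ _ d F (graph_param Phi) (fps_trunc d F) (graphv P).
apply: (ord_agree (h _ _ _)) => [i|m hm|i|].
- exact: graph_param0.
- by rewrite fps_truncE ltnW.
- exact: agree_graph.
rewrite -/(res _ _) -raddfB; apply: ord_res => // m hm.
rewrite mcoeffB hG // fps_truncE (leq_trans (mdeg_le_mwt m) (ltnW hm)) subrr //.
Qed.

End Graph.

Section Existence.
Context (R : realType) (n : nat) (n_gt0 : (0 < n)%N).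
Local Notation C := R[i].
Context (E : fps R (n + n)) (hE : order_ge3 E).
Local Notation Phi := (quadric_plus E).

(** Corrections to the identity in z and in w, and the normal form reached so far. *)
Record jet := Jet {
  jz : 'I_n -> {mpoly C[n + 1]}; jw : {mpoly C[n + 1]}; jphi : {mpoly C[n + n]} }.
Implicit Types (s t : jet) (P : {mpoly C[n + n]}).

Definition jzmap P s (l : 'I_n) := res P ('X_(lshift 1 l) + jz s l).

Definition defect P s : {mpoly C[n + n]} :=
  res P ('X_(rshift n ord0) + jw s) - subst (cpair (jzmap P s)) (quad R n + jphi s).

(** The last clause holds for every P that agrees with Phi below D, so that P can be refined as D
    grows. *)
Definition solved D s : Prop :=
  [/\ forall l, wtord 2 (jz s l), wtord 3 (jw s), ord 3 (jphi s),
      normalized (lam (cof (jphi s)))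
    & forall P, agree D P Phi -> ord D (defect P s)].

Definition extends D s t : Prop :=
  [/\ forall l, wtord D.-1 (jz t l - jz s l), wtord D (jw t - jw s)
    & ord D (jphi t - jphi s)].

Lemma res_z P l : res P 'X_(lshift 1 l) = 'X_(lshift n l).
Proof. by rewrite /res substX /graphv pairvL. Qed.

Lemma res_w P : res P 'X_(rshift n ord0) = P.
Proof. by rewrite /res substX /graphv pairvR. Qed.

Lemma jzmapE P s l : jzmap P s l = 'X_(lshift n l) + res P (jz s l).
Proof. by rewrite /jzmap {1}/res raddfD /= -!/(res _ _) res_z. Qed.

Lemma solved_start : solved 3 (Jet (fun=> 0) 0 0).
Proof.
split=> [_|||| P hP] /=; try exact: wtord_0; try exact: ord_0; first exact: normalized0.
rewrite /defect /= !addr0 res_w.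
have -> : subst (cpair (jzmap P (Jet (fun=> 0) 0 0))) (quad R n) = quad R n.
  rewrite -[RHS]subst_cpairX !subst_cpair_quad; apply: eq_bigr => l _.
  by rewrite jzmapE /= /res raddf0 addr0.
exact: (quad_E hE hP).
Qed.

Lemma defect_congr s P P' D : ord D (P - P') -> ord D (defect P s - defect P' s).
Proof.
move=> h; rewrite /defect opprD opprK addrACA.
apply: ordD; first exact: res_congr.
rewrite addrC; apply: ord_subst_congr; apply: ord_cpairB => l.
by rewrite -opprB; apply/ordN/res_congr.
Qed.

Lemma solved_step D s : (2 < D)%N -> solved D s ->
  exists2 t, solved D.+1 t & extends D s t.
Proof.
(* P0 has to agree with Phi in degree D too, the degree in which the defect is corrected. *)
move=> D3 [hz hw hphi hn hD]; set P0 := fps_trunc D Phi.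
have hP0 : agree D.+1 P0 Phi by apply: agree_trunc.
have [df [dg [dpsi [h1 h2 h3 h4 h5]]]] :=
  homological_equation n_gt0 D3 (hD _ (agree_le (leqnSn D) hP0)).
pose t := Jet (fun l => jz s l + df l) (jw s + dg) (jphi s + dpsi).
exists t; last by split=> [l||] /=; rewrite addrC addKr.
split=> [l|||| P hP] /=.
- by apply: wtordD => //; apply: (wtord_le _ (h1 l)); lia.
- by apply: wtordD => //; apply: (wtord_le _ h2); lia.
- by apply: ordD => //; apply: (ord_le _ h3); lia.
- exact: normalizedD.
have q3 : ord 3 (P - quad R n) by apply: (quad_E hE hP); lia.
have P2 := ord2_quad q3; have Prel := rel_quad q3.
pose Z l : {mpoly C[n + n]} := 'X_(lshift n l).
pose F := jzmap P s; pose d l := res P (df l); pose dq l := res (quad R n) (df l).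
have FE l : F l = Z l + res P (jz s l) by apply: jzmapE.
have F'E l : jzmap P t l = F l + d l.
  by rewrite jzmapE FE /= {1}/res raddfD /= addrA.
have F2 l : ord 2 (F l - Z l) by rewrite FE addrC addKr; apply: ord_res.
have d1 l : ord D.-1 (d l) by apply: ord_res.
have d2 l : ord D (d l - dq l).
  by case: (res_rel Prel (h1 l)) => _ _; rewrite addn1 prednK //; lia.
have Z1 l : ord 1 (Z l) by apply: ordX.
have F1 l : ord 1 (F l).
  by rewrite -(subrK (Z l) (F l)); apply: ordD => //; apply: (ord_le _ (F2 l)).
have F1' l : ord 1 (jzmap P t l).
  by rewrite F'E; apply: ordD => //; apply: (ord_le _ (d1 l)); lia.
(* The degree D part of the change in |z'|^2 is 2 Re <df, z>. Products of d with F - Z gain a degree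
   because F - Z has order 2, and |d|^2 has order 2(D - 1) > D because D > 2. *)
have a1 : ord D.+1 (\sum_l jzmap P t l * cj (jzmap P t l) - \sum_l F l * cj (F l)
    - (zbar_pair df + cj (zbar_pair df))).
  rewrite /zbar_pair [cj _]raddf_sum /= -big_split /= -!sumrB; apply: ord_sum => l _.
  rewrite F'E cjM cjX swap_varR !cjD -/(dq l) -/(Z l).
  have -> : 'X_(rshift n l) = cj (Z l) by rewrite cjX swap_varL.
  have -> : (F l + d l) * (cj (F l) + cj (d l)) - F l * cj (F l) -
      (cj (Z l) * dq l + Z l * cj (dq l)) =
      d l * cj (F l - Z l) + (F l - Z l) * cj (d l) + d l * cj (d l)
      + (d l - dq l) * cj (Z l) + Z l * cj (d l - dq l).
    rewrite !cjB.
    move: (cj (F l)) (cj (d l)) (cj (dq l)) (cj (Z l)) (F l) (d l) (dq l) (Z l) => *.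
    by ring.
  have D1 := ord_cj (d1 l); have D2 := ord_cj (d2 l).
  have Fc := ord_cj (F2 l); have Zc := ord_cj (Z1 l).
  do 4?[apply: ordD].
  - by apply: (ord_le _ (ordM (d1 l) Fc)); lia.
  - by apply: (ord_le _ (ordM (F2 l) D1)); lia.
  - by apply: (ord_le _ (ordM (d1 l) D1)); lia.
  - by apply: (ord_le _ (ordM (d2 l) Zc)); lia.
  - by apply: (ord_le _ (ordM (Z1 l) D2)); lia.
(* The arguments move by order D - 1 and [jphi s] has order 3, so the change has order at least 2 +
   (D - 1). *)
have a2 : ord D.+1 (subst (cpair (jzmap P t)) (jphi s) - subst (cpair F) (jphi s)).
  have [||_ _] := @ord_subst_rel _ _ _ 3 D.-2 (cpair (jzmap P t)) (cpair F) (jphi s).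
  - apply: rel_cpair => l; split=> //; rewrite F'E addrC addKr.
    by apply: (ord_le _ (d1 l)); lia.
  - exact: hphi.
  - by apply: ord_le; lia.
have a3 : ord D.+1 (subst (cpair (jzmap P t)) dpsi - dpsi).
  have [||_ _] := @ord_subst_rel _ _ _ D 1 (cpair (jzmap P t)) (cpair Z) dpsi.
  - apply: rel_cpair => l; split=> //; rewrite F'E addrAC.
    by apply: ordD; [exact: F2 | apply: (ord_le _ (d1 l)); lia].
  - exact: h3.
  - by rewrite subst_cpairX addn1.
have a4 : ord D.+1 (res P dg - res (quad R n) dg).
  by case: (res_rel Prel h2) => _ _; rewrite addn1.
have a5 : ord D.+1 (defect P s - defect P0 s).
  by apply: defect_congr; apply: agree_ord hP hP0.
have -> : defect P t = res P ('X_(rshift n ord0) + jw s) + res P dg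
    - (\sum_l jzmap P t l * cj (jzmap P t l) + subst (cpair (jzmap P t)) (jphi s)
       + subst (cpair (jzmap P t)) dpsi).
  by rewrite /defect /= !addrA [in LHS]resD !substD subst_cpair_quad.
have eP : defect P s = res P ('X_(rshift n ord0) + jw s) -
    (\sum_l F l * cj (F l) + subst (cpair F) (jphi s)).
  by rewrite /defect substD subst_cpair_quad.
(* The new defect is the expression in [h5] up to the five errors just bounded. *)
have := ordB (ordB (ordB (ordD (ordD h5 a5) a4) a1) a2) a3; congr ord.
rewrite eP /hop.
move: (res P ('X_(rshift n ord0) + jw s)) (res P dg) (res _ dg) (defect P0 s) => x1 x2 x3 x4.
set x5 := \sum_l F l * cj (F l); set x6 := \sum_l jzmap P t l * cj (jzmap P t l).
set x7 := subst (cpair F) (jphi s); set x8 := subst (cpair (jzmap P t)) (jphi s).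
set x9 := subst _ dpsi.
set x10 := zbar_pair df + _; move: x5 x6 x7 x8 x9 x10 => x5 x6 x7 x8 x9 x10.
by ring.
Qed.

Lemma mwt1 i : mwt U_(i)%MM = @wt n i.
Proof.
rewrite /mwt (bigD1 i) //= big1 ?addn0 => [|j /negbTE ne]; first by rewrite mnm1E eqxx muln1.
by rewrite mnm1E eq_sym ne muln0.
Qed.

Lemma mwt0 : mwt (0%MM : 'X_{1..n + 1}) = 0%N.
Proof. by rewrite /mwt big1 // => i _; rewrite mnm0E muln0. Qed.

(** Formal limit of the jets: the step from jet k to the next has weight at least k + 2 in z and k +
    3 in w, so every coefficient stabilizes. *)
Lemma pseudo_normal_form_exists : exists phi, pseudo_normal_form Phi phi.
Proof.
have [s hs] := @dependent_choice jet (fun k => solved k.+3) (fun k => extends k.+3)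
  (ex_intro _ _ solved_start) (fun k st => @solved_step k.+3 st isT).
have stable k j : [/\ forall l, wtord k.+2 (jz (s (k + j)%N) l - jz (s k) l),
    wtord k.+3 (jw (s (k + j)%N) - jw (s k)) & ord k.+3 (jphi (s (k + j)%N) - jphi (s k))].
  elim: j => [|j [i1 i2 i3]].
    rewrite (addn0 k); split=> [l||]; rewrite subrr; last exact: ord_0.
      exact: wtord_0.
    exact: wtord_0.
  rewrite (addnS k j); have [_ [e1 e2 e3]] := hs (k + j)%N; split=> [l||].
  - rewrite -(subrK (jz (s (k + j)%N) l) (jz _ l)) -addrA.
    by apply: wtordD (i1 l); apply: (wtord_le _ (e1 l)); rewrite /=; lia.
  - rewrite -(subrK (jw (s (k + j)%N)) (jw _)) -addrA.
    by apply: wtordD i2; apply: (wtord_le _ e2); lia.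
  - rewrite -(subrK (jphi (s (k + j)%N)) (jphi _)) -addrA.
    by apply: ordD i3; apply: (ord_le _ e3); lia.
have cz k l m : (mwt m <= k)%N -> (jz (s k) l)@_m = (jz (s (mwt m)) l)@_m.
  move=> h; have [i1 _ _] := stable (mwt m) (k - mwt m)%N.
  by apply/subr0_eq; rewrite -mcoeffB -{1}(subnKC h) i1.
have cw k m : (mwt m <= k)%N -> (jw (s k))@_m = (jw (s (mwt m)))@_m.
  move=> h; have [_ i2 _] := stable (mwt m) (k - mwt m)%N.
  by apply/subr0_eq; rewrite -mcoeffB -{1}(subnKC h) i2 // ltnW.
have cphi k m : (mdeg m <= k)%N -> (jphi (s k))@_m = (jphi (s (mdeg m)))@_m.
  move=> h; have [_ _ i3] := stable (mdeg m) (k - mdeg m)%N.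
  by apply/subr0_eq; rewrite -mcoeffB -{1}(subnKC h) i3 // ltnW.
(* The coefficient at m is taken from jet number [mwt m], after which it no longer changes. *)
pose H : 'I_(n + 1) -> fps R (n + 1) :=
  pairv (fun l m => ('X_(lshift 1 l) + jz (s (mwt m)) l)@_m)
        (fun=> fun m => ('X_(rshift n ord0) + jw (s (mwt m)))@_m).
pose phi : fps R (n + n) := fun m => (jphi (s (mdeg m)))@_m.
have H0 i : H i 0%MM = 0.
  have [[hz hw _ _ _] _] := hs 0%N; case: (split_ordP i) => j ->; rewrite /H ?(pairvL, pairvR).
    by rewrite mcoeffD mwt0 hz ?mwt0 // mcoeffX (negbTE (negbT (mnm1_eq0 _))) addr0.
  by rewrite mcoeffD mwt0 hw ?mwt0 // mcoeffX (negbTE (negbT (mnm1_eq0 _))) addr0.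
exists phi; split.
- by move=> m hm; rewrite /phi; have [[_ _ h _ _] _] := hs (mdeg m); apply: h.
- exists (lam phi); first by apply/(is_expansionP phi).
  (* Each normalization condition involves coefficients of a single degree, so the limit inherits it
     from one jet. *)
  have L k I J K : (mdeg I + mdeg J + (mdeg K).*2 <= k)%N ->
      lam phi I J K = lam (cof (jphi (s k))) I J K.
    by move=> h; apply: lam_local => m hm; rewrite /phi /cof (cphi _ _ (leq_trans hm h)).
  have N k : normalized (lam (cof (jphi (s k)))) by have [[_ _ _ h _] _] := hs k.
  split=> [t ht|l i hl hi|l i j hl hij|I hI|].
  + by rewrite (L _ _ _ _ (leqnn _)); move: (mdeg _ + mdeg _ + _)%N => d;
    have [h _ _ _ _] := N d; apply: h.
  + by rewrite (L _ _ _ _ (leqnn _)); move: (mdeg _ + mdeg _ + _)%N => d;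
    have [_ h _ _ _] := N d; apply: h.
  + by rewrite (L _ _ _ _ (leqnn _)); move: (mdeg _ + mdeg _ + _)%N => d;
    have [_ _ h _ _] := N d; apply: h.
  + split=> [l hl|l hl|k j hj]; rewrite (L _ _ _ _ (leqnn _)); move: (mdeg _ + mdeg _ + _)%N => d;
    have [_ _ _ h _] := N d;
    by have [h1 h2 h3] := h I hI; auto.
  + split=> [k h I hI hh|I hI].
      by rewrite (L _ _ _ _ (leqnn _)); move: (mdeg _ + mdeg _ + _)%N => d;
    have [_ _ _ _ [h' _]] := N d; apply: h'.
    rewrite !(L (mdeg I)) ?mdeg0 ?addn0 // ?add0n //.
    by have [_ _ _ _ [_ h']] := N (mdeg I); apply: h'.
- exists H.
    (* The linear part is block triangular with identity blocks: a z-correction has weight at least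
       2, so linearly it involves only w, and a w-correction has weight at least 3, so it has no
       linear term. *)
    split=> //; set M := \matrix_(_, _) _.
    rewrite unitmxE -[M]submxK.
    have -> : ulsubmx M = 1%:M.
      apply/matrixP => i j; rewrite !mxE /H pairvL mcoeffD mcoeffXU eq_lshift.
      have [[hz _ _ _ _] _] := hs 1%N.
      by rewrite mwt1 /wt pairvL hz ?addr0 // mwt1 /wt pairvL.
    have -> : dlsubmx M = 0.
      apply/matrixP => i j; rewrite !mxE /H pairvR mcoeffD mcoeffXU eq_rlshift.
      have [[_ hw _ _ _] _] := hs 1%N.
      by rewrite mwt1 /wt pairvL hw ?addr0 // mwt1 /wt pairvL.
    have -> : drsubmx M = 1%:M.
      apply/matrixP => i j; have -> : i = ord0 by apply: val_inj; rewrite (ord1 i).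
      have -> : j = ord0 by apply: val_inj; rewrite (ord1 j).
      rewrite !mxE /H pairvR mcoeffD mcoeffXU !eqxx.
      have [[_ hw _ _ _] _] := hs 2%N.
      by rewrite mwt1 /wt pairvR hw ?addr0 // mwt1 /wt pairvR.
    by rewrite det_ublock !det1 mulr1 unitr1.
  move=> m; pose H_M i := fps_comp (H i) (graph_param Phi); set d := mdeg m.
  change (H_M (rshift n ord0) m = fps_comp (quadric_plus phi)
    (pairv (fun j => H_M (lshift 1 j)) (fun j => fps_conj (H_M (lshift 1 j)))) m).
  have [[hz hw hphi _ hdef] _] := hs d; set st := s d in hz hw hphi hdef.
  (* Jet d is solved below degree d + 3, so P has to agree with Phi that far. *)
  set P := fps_trunc d.+2 Phi; have hP : agree d.+3 P Phi by apply: agree_trunc.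
  have P2 : ord 2 P by apply: ord2_quad; apply: (quad_E hE hP).
  have hP1 : agree d.+1 P Phi by apply: agree_le hP; lia.
  have aw : agree d.+1 (res P ('X_(rshift n ord0) + jw st)) (H_M (rshift n ord0)).
    apply: agree_res => //; first exact: quadric0.
    by move=> k hk; rewrite /H pairvR !mcoeffD /st cw.
  have az l : agree d.+1 (jzmap P st l) (H_M (lshift 1 l)).
    apply: agree_res => //; first exact: quadric0.
    by move=> k hk; rewrite /H pairvL !mcoeffD /st cz.
  have HM0 i : H_M i 0%MM = 0 by rewrite /H_M fps_comp0.
  have aphi : agree d.+1 (quad R n + jphi st) (quadric_plus phi).
    by move=> k hk; rewrite mcoeffD /st cphi.
  have arhs : agree d.+1 (subst (cpair (jzmap P st)) (quad R n + jphi st))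
    (fps_comp (quadric_plus phi) (pairv (fun j => H_M (lshift 1 j))
       (fun j => fps_conj (H_M (lshift 1 j))))).
    apply: agree_comp => // i.
      rewrite /pairv; case: split => // j.
      rewrite /fps_conj (_ : [multinom _ | _ < _] = 0%MM) ?HM0 ?conjc0 //.
      by apply/mnmP => x; rewrite !mnmE.
    case: (split_ordP i) => j ->; rewrite /cpair ?pairvL ?pairvR; first exact: az.
    exact/agree_conj/az.
  rewrite -(aw m) // -(arhs m) //; apply/subr0_eq; rewrite -mcoeffB.
  by apply: (hdef P hP); rewrite /d; lia.
Qed.

End Existence.

(** * Reality of pseudo-normal forms *)

Section Rigidity.
Context (R : realType) (n : nat) (n_gt0 : (0 < n)%N).
Local Notation C := R[i].
Implicit Types (P f : {mpoly C[n + n]}) (G Q T : {mpoly C[n + 1]}) (I J K : 'X_{1..n}).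
Local Notation qd := (quad R n).

Lemma ord_sym s f g : ord s (f - g) -> ord s (g - f).
Proof. by rewrite -opprB => h; rewrite -[g - f]opprK; apply: ordN. Qed.

Lemma ord_trans s f g h : ord s (f - g) -> ord s (g - h) -> ord s (f - h).
Proof. by move=> h1 h2; rewrite -(subrK g f) -addrA; apply: ordD. Qed.

Definition skew f : {mpoly C[n + n]} := cj f - f.

Lemma skewD f g : skew (f + g) = skew f + skew g.
Proof. by rewrite /skew cjD opprD addrACA. Qed.

Lemma ord_skewB s f g : ord s (f - g) -> ord s (skew f - skew g).
Proof.
move=> h; rewrite (_ : skew f - skew g = cj (f - g) - (f - g)).
  by apply: ordB => //; apply: ord_cj.
by rewrite /skew cjB !opprB addrACA [RHS]addrACA [- cj g + _]addrC.
Qed.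

Definition real_upto s f : Prop := ord s (skew f).

Lemma real_upto_congr s f g : ord s (f - g) -> real_upto s f -> real_upto s g.
Proof.
move=> h hf; rewrite /real_upto -(subrK (skew f) (skew g)).
by apply: ordD => //; apply/ord_skewB/ord_sym.
Qed.

Lemma real_upto_le s t f : (t <= s)%N -> real_upto s f -> real_upto t f.
Proof. by move=> le; apply: ord_le. Qed.

Lemma real_uptoD s f g : real_upto s f -> real_upto s g -> real_upto s (f + g).
Proof. by move=> hf hg; rewrite /real_upto skewD; apply: ordD. Qed.

Lemma real_uptoZ s (b : C) f : conjc b = b -> real_upto s f -> real_upto s (b *: f).
Proof. by move=> hb hf; rewrite /real_upto /skew cjZ hb -scalerBr; apply: ordZ. Qed.

Lemma real_uptoB s f g : real_upto s f -> real_upto s g -> real_upto s (f - g).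
Proof.
move=> hf hg; rewrite -scaleN1r; apply: real_uptoD => //; apply: real_uptoZ => //.
by rewrite -[-1]sub0r conjcB conjc0 conjc1.
Qed.

Lemma real_uptoX s f k : real_upto s f -> real_upto s (f ^+ k).
Proof. by move=> h; have [_ _] := relX k (rel0 h); rewrite mul0n /real_upto /skew rmorphXn. Qed.

Lemma wtordS s G : wtord s G ->
  (forall I k, (mdeg I + 2 * k = s)%N -> G@_(mzw I k) = 0) -> wtord s.+1 G.
Proof.
move=> h1 h2 m; rewrite ltnS leq_eqVlt => /orP [/eqP hm|/h1 //].
by rewrite (mzwP m); apply: h2; rewrite -mwt_mzw -mzwP.
Qed.

(** Distinct z^I w^k restrict to distinct basis terms, so nothing cancels on the quadric and the
    order of the restriction bounds the weight. *)
Lemma ord_res_wtord s G : ord s (res qd G) -> wtord s G.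
Proof.
move=> h m; rewrite (mzwP m) mwt_mzw; set I := [multinom _ | _ < _]; set k := m _ => hs.
have := @lam_res R n n_gt0 G I 0 (e1 n *+ k) (disjm0r I).
rewrite mdegMn mdeg_e1 // mul1n !eqxx /= => <-; rewrite -(lam0 R I 0 (e1 n *+ k)).
apply: lam_local => x; rewrite mdeg0 mdegMn mdeg_e1 // mul1n addn0 -mul2n => hx.
by rewrite /cof mcoeff0 h //; apply: leq_ltn_trans hs.
Qed.

Lemma lam_res_real s G I J K : real_upto s.+1 (res qd G) ->
  (mdeg I + mdeg J + (mdeg K).*2 <= s)%N ->
  conjc (lam (cof (res qd G)) J I K) = lam (cof (res qd G)) I J K.
Proof.
rewrite /real_upto /skew => h hs; rewrite -lam_cj; apply: lam_local => m hm.
by apply/subr0_eq; rewrite /cof -mcoeffB h //; apply: leq_trans hs.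
Qed.

(** Reality equates the coefficient of z^I u^k with the conjugate of that of zbar^I u^k, which is 0
    for I != 0. The weight s part is therefore a real multiple of a power of w. *)
Lemma weight_real s P G : rel 2 1 P qd -> wtord s G ->
  real_upto s.+1 (res P G) ->
  (forall I k, (mdeg I + 2 * k = s)%N -> I != 0%MM -> G@_(mzw I k) = 0) /\
  (forall k, (2 * k = s)%N -> conjc G@_(mzw 0 k) = G@_(mzw 0 k)).
Proof.
move=> hP hG hr.
have hq : real_upto s.+1 (res qd G).
  have [_ _] := res_rel hP hG; rewrite addn1 => hPq.
  exact: real_upto_congr hPq hr.
have hk I k : (mdeg I + 2 * k = s)%N ->
    (mdeg I + mdeg (0%MM : 'X_{1..n}) + (mdeg (e1 n *+ k)%MM).*2 <= s)%N.
  by move=> <-; rewrite mdeg0 mdegMn mdeg_e1 // mul1n addn0 mul2n.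
split=> [I k /hk hI nI|k hk2].
  have := lam_res_real hq hI.
  rewrite !(lam_res n_gt0) ?disjm0l ?disjm0r // (negbTE nI) /= raddf0.
  by rewrite mdegMn mdeg_e1 // mul1n !eqxx /= => <-.
have := lam_res_real hq (hk 0%MM k _); rewrite mdeg0 => /(_ hk2).
by rewrite !(lam_res n_gt0) ?disjm0l // mdegMn mdeg_e1 // mul1n !eqxx.
Qed.

Lemma mzw_w : mzw 0 1 = U_(rshift n ord0)%MM :> 'X_{1..n + 1}.
Proof.
apply/esym; rewrite (mzwP U_(_)) mnm1E eqxx; congr mzw.
by apply/mnmP => l; rewrite mnmE mnm1E mnm0E eq_rlshift.
Qed.

Lemma real_leading_w P G : rel 2 1 P qd -> G@_0%MM = 0 ->
  real_upto 3 (res P G) ->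
  let c := G@_U_(rshift n ord0) in
  conjc c = c /\ wtord 3 (G - c *: 'X_(rshift n ord0)).
Proof.
move=> hP G0 hr c.
have w1 : wtord 1 G.
  move=> m; rewrite ltnS leqn0 => /eqP hm; have := mdeg_le_mwt m.
  by rewrite hm leqn0 mdeg_eq0 => /eqP ->.
have w2 : wtord 2 G.
  apply: wtordS => // I k hI; have [h _] := weight_real hP w1 (@real_upto_le 3 2 _ isT hr).
  by apply: h => //; apply/eqP => I0; rewrite I0 mdeg0 in hI; lia.
have [h1 h2] := weight_real hP w2 hr.
split; first by have := h2 1%N erefl; rewrite mzw_w.
have wc : wtord 2 (c *: 'X_(rshift n ord0) : {mpoly C[n + 1]}).
  by apply: wtordZ; rewrite -mzw_w; have := @wtordX R n 0 1; rewrite mdeg0.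
apply: wtordS => [|I k hI]; first exact: wtordB.
rewrite mcoeffB mcoeffZ mcoeffX; have [I0|nI] := eqVneq I 0%MM.
  have -> : k = 1%N by rewrite I0 mdeg0 in hI; lia.
  by rewrite I0 mzw_w eqxx mulr1 subrr.
rewrite h1 // sub0r -mzw_w; case: eqP => [e|]; last by rewrite mulr0 oppr0.
case/eqP: nI; apply/mnmP => l; have := congr1 (fun m : 'X_{1..n + 1} => m (lshift 1 l)) e.
by rewrite !mnmE !pairvL mnm0E.
Qed.

(* Peels off one weight at a time: a real leading term a w^k on the quadric is
   cancelled by the real multiple (a / c^k) G^k. *)
Lemma real_approximation d P G G' (c : C) : rel 2 1 P qd ->
  c != 0 -> conjc c = c -> wtord 3 (G - c *: 'X_(rshift n ord0)) ->
  real_upto d.+1 (res P G) -> real_upto d (res P G') ->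
  exists2 Q, real_upto d.+1 (res P Q) & wtord d (G' - Q).
Proof.
move=> hP c0 cr hG rG rG'.
(* Q is real through degree d although G' is real only below d: the nonreal part in degree d stays
   in G' - Q. *)
suff h s : (s <= d)%N ->
    exists2 Q, real_upto d.+1 (res P Q) & wtord s (G' - Q) by apply: h.
elim: s => [_|s IH hs].
  by exists 0 => //; rewrite res0 /real_upto /skew cj0 subrr; apply: ord_0.
have [Q rQ wQ] := IH (ltnW hs); set T := G' - Q in wQ.
have rT : real_upto s.+1 (res P T).
  by rewrite /T resB; apply: real_uptoB; [exact: real_upto_le rG' | apply: real_upto_le rQ; lia].
have [h1 h2] := weight_real hP wQ rT.
(* For odd s no power of w has weight s, so the weight s part already vanishes. *)
have [os|es] := boolP (odd s).
  exists Q => //; apply: wtordS => // I k hI; apply: h1 => //.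
  by apply/eqP => I0; rewrite I0 mdeg0 in hI; move: os; rewrite -hI; lia.
set k := s./2; have ks : (2 * k)%N = s by rewrite mul2n -[RHS]odd_double_half (negbTE es).
set a := T@_(mzw 0 k); pose b := a / c ^+ k.
have br : conjc b = b.
  by rewrite /b rmorphM fmorphV rmorphXn /= cr -/(conjc a) /a h2.
exists (Q + b *: G ^+ k).
  by rewrite resD resZ resX; apply: real_uptoD => //; apply/real_uptoZ/real_uptoX.
rewrite opprD addrA -/T; apply: ord_res_wtord.
have e1' : ord s.+1 (res qd T - a *: qd ^+ k).
  have -> : a *: qd ^+ k = res qd (a *: 'X_[mzw 0 k]).
    rewrite resZ res_mzw (_ : mjoin 0 0 = 0%MM) ?mpolyX0 ?mul1r //.
    by apply/esym/mjoinP => l; rewrite !mnm0E.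
  rewrite -resB; apply: ord_res; first exact: ord_quad.
  apply: wtordS => [|I j hI].
    apply: wtordB => //; apply: wtordZ; rewrite -ks.
    by have := @wtordX R n 0 k; rewrite mdeg0.
  rewrite mcoeffB mcoeffZ mcoeffX; have [I0|nI] := eqVneq I 0%MM.
    have -> : j = k by rewrite I0 mdeg0 -ks in hI; lia.
    by rewrite I0 eqxx mulr1 subrr.
  rewrite h1 // sub0r; case: eqP => [e|]; last by rewrite mulr0 oppr0.
  case/eqP: nI; apply/mnmP => l; have := congr1 (fun m : 'X_{1..n + 1} => m (lshift 1 l)) e.
  by rewrite !mnmE !pairvL mnm0E.
have e2' : ord s.+1 (res qd (b *: G ^+ k) - a *: qd ^+ k).
  have hg : rel 2 1 (res qd G) (c *: qd).
    have hd : ord 3 (res qd G - c *: qd).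
      have := @ord_res R n 3 qd _ (@ord_quad R n) hG.
      by rewrite resB resZ res_w.
    split=> //; last by apply/ordZ/ord_quad.
    rewrite -(subrK (c *: qd) (res qd G)); apply: ordD; last by apply/ordZ/ord_quad.
    exact: (ord_le _ hd).
  have [_ _] := relX k hg; rewrite ks addn1 => hk.
  have := ordZ b hk; congr ord; rewrite resZ resX scalerBr.
  by rewrite exprZn scalerA /b mulrVK // unitfE expf_neq0.
by rewrite resB; apply: ord_trans e1' (ord_sym e2').
Qed.

Definition linz (A : 'M[C]_n) (l : 'I_n) : {mpoly C[n + n]} :=
  \sum_j A l j *: 'X_(lshift n j).

Lemma ord_linz A l : ord 1 (linz A l).
Proof. by apply: ord_sum => j _; apply/ordZ/ordX. Qed.

Lemma subst_cpair_linz A B l : subst (cpair (linz B)) (linz A l) = linz (A *m B) l.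
Proof.
rewrite /linz raddf_sum /=.
under eq_bigr do rewrite substZ substX /cpair pairvL scaler_sumr.
rewrite exchange_big; apply: eq_bigr => k _ /=.
by rewrite mxE scaler_suml; apply: eq_bigr => j _; rewrite scalerA.
Qed.

Lemma cpair_linzK A B f : A *m B = 1%:M ->
  subst (cpair (linz B)) (subst (cpair (linz A)) f) = f.
Proof.
move=> AB; rewrite substA -[RHS]subst_cpairX; apply: eq_subst => i.
have h l : subst (cpair (linz B)) (linz A l) = 'X_(lshift n l).
  rewrite subst_cpair_linz AB /linz (bigD1 l) //= big1 ?addr0 ?mxE ?eqxx ?scale1r // => j ne.
  by rewrite mxE eq_sym (negbTE ne) scale0r.
case: (split_ordP i) => j ->; rewrite /cpair ?(pairvL, pairvR) -/(cpair _) ?h //.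
by rewrite subst_cj ?h // => x; rewrite cpair_swap.
Qed.

(* On the quadric, a dilated unitary change z = B z' turns T(z, |z|^2) into
   another such polynomial. *)
Lemma subst_linz_res d B (a : C) T :
  ord 3 (subst (cpair (linz B)) qd - a *: qd) -> wtord d T ->
  exists T', ord d.+1 (subst (cpair (linz B)) (res qd T) - res qd T').
Proof.
move=> hB hT.
pose v : 'I_(n + 1) -> {mpoly C[n + 1]} :=
  pairv (fun l => \sum_j B l j *: 'X_(lshift 1 j)) (fun=> a *: 'X_(rshift n ord0)).
exists (subst v T).
have L1 := ord_cpair (@ord_linz B).
have [||_ _] := @rel_subst _ _ _ (@wt n) d 1
  (fun i => subst (cpair (linz B)) (graphv qd i)) (pairv (linz B) (fun=> a *: qd)) T.
- move=> i; case: (split_ordP i) => j ->; rewrite /graphv /wt ?(pairvL, pairvR).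
    by rewrite substX /cpair pairvL; apply/rel_refl/ord_linz.
  split=> //; last by apply/ordZ/ord_quad.
  exact: ord_subst (@ord_quad R n).
- by move=> m; case: leqP => // h; rewrite hT ?eqxx.
have -> : res qd (subst v T) = subst (pairv (linz B) (fun=> a *: qd)) T.
  rewrite /res substA; apply: eq_subst => i.
  case: (split_ordP i) => j ->; rewrite /v ?(pairvL, pairvR).
    rewrite raddf_sum /=; apply: eq_bigr => k _.
    by rewrite substZ substX /graphv pairvL.
  by rewrite substZ substX /graphv pairvR.
by rewrite addn1 /res substA.
Qed.

Lemma subst_skew (F : 'I_n -> {mpoly C[n + n]}) f :
  subst (cpair F) (skew f) = skew (subst (cpair F) f).
Proof. by rewrite /skew raddfB /= subst_cj //; apply: cpair_swap. Qed.

Lemma mzw0 : mzw 0 0 = 0%MM :> 'X_{1..n + 1}.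
Proof. by apply/mnmP => i; rewrite mnmE mnm0E /pairv; case: split => // j; rewrite mnm0E. Qed.

Lemma mzw_z (j : 'I_n) : mzw U_(j) 0 = U_(lshift 1 j)%MM.
Proof.
apply/esym; rewrite (mzwP U_(_)) mnm1E eq_lrshift; congr mzw.
by apply/mnmP => l; rewrite mnmE !mnm1E eq_lshift.
Qed.

End Rigidity.

(** * Leading terms of a change of coordinates restricted to M *)

Section Transform.
Context (R : realType) (n : nat).
Local Notation C := R[i].
Context (E : fps R (n + n)) (hE : order_ge3 E).
Local Notation Phi := (quadric_plus E).
Local Notation qd := (quad R n).
Context (H : 'I_(n + 1) -> fps R (n + 1)) (hH : formal_change H).
Context (Psi : fps R (n + n)) (hT : transforms H Phi Psi).
Local Notation w := (rshift n (@ord0 0)).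
Variable d : nat.
Hypothesis d3 : (2 < d)%N.
Local Notation P := (fps_trunc d Phi).
Local Notation Ht i := (fps_trunc d (H i)).
Local Notation F := (fun l => res P (Ht (lshift 1 l))).
Local Notation M := (\matrix_(i, j) H i U_(j)%MM : 'M[C]_(n + 1)).

Lemma trunc_rel : rel 2 1 P qd.
Proof. by apply: rel_quad; apply: (quad_E hE (agree_trunc Phi)); lia. Qed.

Lemma agree_restrict i : agree d.+1 (res P (Ht i)) (fps_comp (H i) (graph_param Phi)).
Proof.
have [P2 _ _] := trunc_rel; apply: agree_res => //; first exact: quadric0.
  exact: agree_trunc.
by move=> m hm; rewrite agree_trunc //; apply: leq_ltn_trans (mdeg_le_mwt m) hm.
Qed.

Lemma restrict_ord1 i : ord 1 (res P (Ht i)).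
Proof. by apply: (agree_ord1 _ (@agree_restrict i)); rewrite fps_comp0; apply: hH.1. Qed.

Lemma transforms_ord : ord d.+1 (res P (Ht w) - subst (cpair F) (fps_trunc d Psi)).
Proof.
pose H_M i := fps_comp (H i) (graph_param Phi).
have e m : H_M w m = fps_comp Psi
    (pairv (fun j => H_M (lshift 1 j)) (fun j => fps_conj (H_M (lshift 1 j)))) m.
  exact: hT.
have h0 i : H_M i 0%MM = 0 by rewrite /H_M fps_comp0; apply: hH.1.
have a1 : agree d.+1 (subst (cpair F) (fps_trunc d Psi)) (fps_comp Psi
    (pairv (fun j => H_M (lshift 1 j)) (fun j => fps_conj (H_M (lshift 1 j))))).
  apply: agree_comp; last 1 first.
  - move=> i; case: (split_ordP i) => j ->; rewrite /cpair ?pairvL ?pairvR.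
      exact: agree_restrict.
    by apply: agree_conj; exact: agree_restrict.
  - move=> i; case: (split_ordP i) => j ->; rewrite ?pairvL ?pairvR //.
    rewrite /fps_conj (_ : [multinom _ | _ < _] = 0%MM) ?h0 ?conjc0 //.
    by apply/mnmP => x; rewrite !mnmE.
  - exact: agree_trunc.
by move=> m hm; rewrite mcoeffB a1 // -e (@agree_restrict w) // subrr.
Qed.

(** On M the w-component equals Psi at z' and its conjugate, so it is real as far as Psi is. *)
Lemma restrict_real s : (s <= d.+1)%N ->
  (forall m, (mdeg m < s)%N -> fps_conj Psi m = Psi m) ->
  real_upto s (res P (Ht w)).
Proof.
move=> hs hr; have h1 := ord_le hs transforms_ord.
have h2 : real_upto s (fps_trunc d Psi).
  have ht : agree s (fps_trunc d Psi) Psi by apply: agree_le (agree_trunc _).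
  by move=> m hm; rewrite mcoeffB (agree_conj ht) // ht // hr // subrr.
apply: real_upto_congr (ord_sym h1) _; rewrite /real_upto -subst_skew.
by apply: ord_subst => //; apply: ord_cpair => l; apply: restrict_ord1.
Qed.

(** On M the variable w has order 2, so degree 1 only sees the z-block of the linear part. *)
Lemma linear_part l : ord 2 (res P (Ht (lshift 1 l)) - linz (ulsubmx M) l).
Proof.
have [P2 _ _] := trunc_rel.
have -> : linz (ulsubmx M) l = res P (\sum_j (ulsubmx M) l j *: 'X_(lshift 1 j)).
  rewrite /linz /res raddf_sum /=; apply: eq_bigr => j _.
  by rewrite substZ substX /graphv pairvL.
rewrite -resB; apply: ord_res => //.
have co x : (mdeg x <= d)%N -> (Ht (lshift 1 l) - \sum_j (ulsubmx M) l j *: 'X_(lshift 1 j))@_x =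
    H (lshift 1 l) x - \sum_j H (lshift 1 l) U_(lshift 1 j)%MM * (U_(lshift 1 j)%MM == x)%:R.
  move=> hx; rewrite mcoeffB agree_trunc // raddf_sum /=; congr (_ - _).
  by apply: eq_bigr => j _; rewrite mcoeffZ mcoeffX !mxE.
do 2?[apply: wtordS] => // [I k hI|I k hI].
  have -> : k = 0%N by lia.
  have -> : I = 0%MM by apply/eqP; rewrite -mdeg_eq0; apply/eqP; lia.
  rewrite mzw0 co ?mdeg0 // hH.1 big1 ?subr0 // => j _.
  by rewrite mnm1_eq0 mulr0.
have k0 : k = 0%N by lia.
have /mdeg1P [j /eqP ->] : mdeg I == 1%N by apply/eqP; lia.
rewrite k0 mzw_z co ?mdeg1; last by lia.
rewrite (bigD1 j) //= eqxx mulr1 big1 ?addr0 ?subrr // => i ne.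
by rewrite eq_mnm1 eq_lshift (negbTE ne) mulr0.
Qed.

Context (n_gt0 : (0 < n)%N).
Hypothesis Psi_real2 : forall m, (mdeg m < 3)%N -> fps_conj Psi m = Psi m.

Local Notation c := (H w U_(w)%MM).

(** Reality through degree 2 removes the z-entries from the last row of the linear part. The matrix
    is then block triangular, and its invertibility makes both c and the z-block invertible. *)
Lemma leading_w : [/\ conjc c = c, wtord 3 (Ht w - c *: 'X_w), c != 0 & ulsubmx M \in unitmx].
Proof.
have h0 : (Ht w)@_0%MM = 0 by rewrite agree_trunc ?mdeg0 //; apply: hH.1.
have hc : (Ht w)@_U_(w) = c by rewrite agree_trunc // mdeg1 ltnS; lia.
have := real_leading_w n_gt0 trunc_rel h0 (@restrict_real 3 (ltnW d3) Psi_real2).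
rewrite hc /= => -[cr hw].
have hM : M \in unitmx := hH.2.
have dl0 : dlsubmx M = 0.
  apply/matrixP => i j; have -> : i = ord0 by apply: val_inj; rewrite (ord1 i).
  rewrite !mxE; have := hw U_(lshift 1 j)%MM; rewrite mwt1 /wt pairvL => /(_ isT).
  rewrite mcoeffB mcoeffZ mcoeffXU eq_rlshift mulr0 subr0 agree_trunc // mdeg1 ltnS; lia.
have /andP [u1 u2] : (\det (ulsubmx M) \is a GRing.unit) && (\det (drsubmx M) \is a GRing.unit).
  by rewrite -unitrM -(det_ublock _ (ursubmx M)) -dl0 submxK -unitmxE.
by split=> //; move: u2; rewrite det_mx11 !mxE unitfE.
Qed.

End Transform.

(** * Induction on the degree, and the equivalence *)

Section Final.
Context (R : realType) (n : nat) (n_gt0 : (0 < n)%N).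
Local Notation C := R[i].
Local Notation qd := (quad R n).
Local Notation w := (rshift n (@ord0 0)).

Lemma quadric_skew (phi : fps R (n + n)) m :
  fps_conj (quadric_plus phi) m - quadric_plus phi m = fps_conj phi m - phi m.
Proof.
have h : conjc qd@_(mswap m) = qd@_m by rewrite -cjE cj_quad.
rewrite /fps_conj -/(mswap m) /quadric_plus -/(quad R n) conjcD h.
by rewrite opprD addrACA subrr add0r.
Qed.

Lemma defect_holomorphic (E : fps R (n + n)) (hE : order_ge3 E) H Estar H' phi d :
  (2 < d)%N ->
  formal_change H -> transforms H (quadric_plus E) Estar -> formally_real Estar ->
  formal_change H' -> transforms H' (quadric_plus E) (quadric_plus phi) ->
  order_ge3 phi -> (forall m, (mdeg m < d)%N -> fps_conj phi m = phi m) ->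
  exists T, ord d.+1 (skew (fps_trunc d (quadric_plus phi)) - skew (res qd T)).
Proof.
move=> d3 hH hT hr hH' hT' hphi hd.
set P := fps_trunc d (quadric_plus E); set Psi := quadric_plus phi.
have hPsi m : (mdeg m < d)%N -> fps_conj Psi m = Psi m.
  by move=> hm; apply/subr0_eq; rewrite quadric_skew hd // subrr.
have hP : rel 2 1 P qd by exact: (trunc_rel hE d3).
have [cr wG c0 _] := leading_w hE hH hT d3 n_gt0 (fun m _ => hr m).
have rG := restrict_real hE hH hT d3 (leqnn _) (fun m _ => hr m).
have hPsi3 m : (mdeg m < 3)%N -> fps_conj Psi m = Psi m.
  by move=> hm; apply: hPsi; apply: leq_trans hm d3.
have [cr' wG' c0' uA] := leading_w hE hH' hT' d3 n_gt0 hPsi3.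
have rG' := restrict_real hE hH' hT' d3 (leqnSn d) hPsi.
have [Q rQ] := real_approximation n_gt0 hP c0 cr wG rG rG'.
set G' := fps_trunc d (H' w) in wG' rG' *; set T := G' - Q => wT.
set A := ulsubmx _ in uA; pose B := invmx A.
pose F l := res P (fps_trunc d (H' (lshift 1 l))).
have hF l : rel 1 1 (F l) (linz A l).
  split; [exact: (restrict_ord1 hE hH' d3) | exact: ord_linz | exact: (linear_part hE hH' d3)].
have tr : ord d.+1 (res P G' - subst (cpair F) (fps_trunc d Psi)).
  exact: (transforms_ord hE hH' hT' d3).
have ordB' := ord_cpair (@ord_linz R n B).
pose c' := H' w U_(w)%MM.
(* Degree 2 of the transformed equation says |Az|^2 = c'|z|^2: each of e1 to e5 alters only terms of
   degree 3 or more. *)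
have hA : ord 3 (subst (cpair (linz A)) qd - c' *: qd).
  have e1 : ord 3 (subst (cpair (linz A)) qd - subst (cpair F) qd).
    have [_ _] := ord_subst_rel (rel_cpair hF) (@ord_quad R n); exact: ord_sym.
  have e2 : ord 3 (subst (cpair F) qd - subst (cpair F) (fps_trunc d Psi)).
    rewrite -raddfB; apply: ord_subst; first by apply: ord_cpair => l; case: (hF l).
    by apply/ord_sym/(quad_E hphi (agree_trunc _)); lia.
  have e3 : ord 3 (subst (cpair F) (fps_trunc d Psi) - res P G').
    by apply: (ord_le _ (ord_sym tr)); lia.
  have e4 : ord 3 (res P G' - c' *: P).
    have := ord_res (let: And3 h _ _ := hP in h) wG'.
    by rewrite resB resZ res_w.
  have e5 : ord 3 (c' *: P - c' *: qd).
    by rewrite -scalerBr; apply: ordZ; case: hP.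
  exact: ord_trans (ord_trans (ord_trans (ord_trans e1 e2) e3) e4) e5.
have AB : A *m B = 1%:M by rewrite mulmxV.
have hB : ord 3 (subst (cpair (linz B)) qd - c'^-1 *: qd).
  have := ordZ (- c'^-1) (ord_subst ordB' hA); congr ord.
  rewrite raddfB /= cpair_linzK // substZ scalerBr scalerA mulNr mulVf //.
  by rewrite scaleN1r opprK addrC scaleNr.
have [T' hT2] := subst_linz_res hB wT; exists T'.
set q := skew (fps_trunc d Psi).
have oq : ord d q.
  have ht : agree d (fps_trunc d Psi) Psi by apply: agree_le (agree_trunc _).
  by move=> m hm; rewrite mcoeffB (agree_conj ht) // ht // hPsi // subrr.
(* As q has order d, replacing the z-part of the change by its linear part is an error of order d +
   1. *)
have s1 : ord d.+1 (subst (cpair (linz A)) q - subst (cpair F) q).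
  by have [_ _] := ord_subst_rel (rel_cpair hF) oq; rewrite addn1; apply: ord_sym.
have s2 : ord d.+1 (subst (cpair F) q - skew (res P G')).
  by rewrite subst_skew; apply/ord_skewB/ord_sym.
(* Q is real through degree d and drops out. *)
have s3 : ord d.+1 (skew (res P G') - skew (res P T)).
  have -> : res P G' = res P T + res P Q by rewrite /T resB subrK.
  by rewrite skewD [X in ord _ X]addrC addKr.
have s4 : ord d.+1 (skew (res P T) - skew (res qd T)).
  by apply: ord_skewB; have [_ _] := res_rel hP wT; rewrite addn1.
(* Substituting the inverse of A returns to the coordinates of the normal form. *)
have := ord_subst ordB' (ord_trans (ord_trans (ord_trans s1 s2) s3) s4).
rewrite raddfB /= cpair_linzK // subst_skew => h.
exact: ord_trans h (ord_skewB hT2).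
Qed.

Lemma pseudo_normal_form_real (E : fps R (n + n)) phi :
  order_ge3 E -> flattenable (quadric_plus E) ->
  pseudo_normal_form (quadric_plus E) phi -> formally_real phi.
Proof.
move=> hE [Estar [H hH hT] hr] [hphi [c /is_expansionP hc nc] [H' hH' hT']].
suff h d m : (mdeg m < d)%N -> fps_conj phi m = phi m by move=> m; apply: (h (mdeg m).+1).
elim: d m => [//|d IH] m; rewrite ltnS; move: m.
have [d3|d2] := ltnP 2 d; last first.
  move=> m hm; rewrite /fps_conj -/(mswap m) !hphi ?mdeg_mswap ?raddf0 //; lia.
have [T hTT] := defect_holomorphic hE d3 hH hT hr hH' hT' hphi IH.
apply: lam_inj => I J K dIJ hs.
have [lt|ge] := ltnP (mdeg I + mdeg J + (mdeg K).*2) d.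
  by apply: lam_local => m hm; apply: IH; apply: leq_ltn_trans lt.
have {ge}hs' : (mdeg I + mdeg J + (mdeg K).*2)%N = d by apply/eqP; rewrite eqn_leq hs.
have e : lam (fps_conj phi) I J K - lam phi I J K =
    conjc (lam (cof (res qd T)) J I K) - lam (cof (res qd T)) I J K.
  rewrite -lam_cj -lamB -mulN1r addrC -lam_lin; apply: lam_local => m; rewrite hs' => hm.
  rewrite mulN1r addrC -quadric_skew /cof.
  have /subr0_eq hm' : (skew (fps_trunc d (quadric_plus phi)))@_m - (skew (res qd T))@_m = 0.
    by rewrite -mcoeffB hTT.
  have ht := @agree_trunc R (n + n) d (quadric_plus phi).
  by rewrite -[RHS]hm' /skew mcoeffB (agree_conj ht) // ht.
have [n1 _ _ n4 [_ n6]] := nc.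
have kK : K = (e1 n *+ mdeg K)%MM -> (0 < mdeg K)%N \/ K = 0%MM.
  by case: (mdeg K) => [->|k]; [right; rewrite mulm0n | left].
(* Unless K = k e_1 and one of I, J is 0, the right-hand side of [e] vanishes. *)
have [KK|nK] := eqVneq K (e1 n *+ mdeg K)%MM; last first.
  by apply/subr0_eq; rewrite e !lam_res // 1?disjmC // (negbTE nK) !andbF raddf0 subrr.
have [J0|nJ] := eqVneq J 0%MM; last first.
  have [I0|nI] := eqVneq I 0%MM; last first.
    by apply/subr0_eq; rewrite e !lam_res // 1?disjmC // (negbTE nI) (negbTE nJ) raddf0 subrr.
  have J1 : (1 <= mdeg J)%N by rewrite lt0n mdeg_eq0.
  rewrite lam_conj I0 -!hc ?disjm0l ?disjm0r //; have [a1 a2 a3] := n4 J J1.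
  case: (kK KK) => [Kpos|K0]; first by rewrite KK a1 // a2 // raddf0.
  (* Here |J| = d > 2, so the conjugation condition applies. *)
  by rewrite K0 n6 //; move: hs' d3; rewrite I0 K0 !mdeg0; lia.
have [I0|nI] := eqVneq I 0%MM.
  rewrite lam_conj I0 J0 -!hc ?disjm0l // KK n1 ?raddf0 //.
  (* Here 2|K| = d > 2, so |K| >= 2, the range in which powers of u are normalized away. *)
  by rewrite I0 J0 !mdeg0 in hs'; lia.
have I1 : (1 <= mdeg I)%N by rewrite lt0n mdeg_eq0.
rewrite lam_conj J0 -!hc ?disjm0l ?disjm0r //; have [a1 a2 a3] := n4 I I1.
case: (kK KK) => [Kpos|K0]; first by rewrite KK a1 // a2 // raddf0.
by rewrite K0 n6 ?conjcK //; move: hs' d3; rewrite J0 K0 !mdeg0; lia.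
Qed.

End Final.

Theorem theorem3p5 (R : realType) (n : nat) (hn : (2 <= n)%N)
    (E : fps R (n + n)) (hE : order_ge3 E) :
  [<-> flattenable (quadric_plus E);
       exists2 phi, pseudo_normal_form (quadric_plus E) phi
                  & formally_real phi;
       forall phi, pseudo_normal_form (quadric_plus E) phi ->
                   formally_real phi].
Proof.
have n_gt0 : (0 < n)%N := ltnW hn.
have [phi0 pnf0] := pseudo_normal_form_exists n_gt0 hE.
split=> [hf|]; last split=> [[phi [_ _ eq_phi] real_phi] psi pnf|all_real].
- by exists phi0 => //; apply: pseudo_normal_form_real pnf0.
(* Since |z|^2 is real, a flat normal form is itself a flattening. *)
- apply: (pseudo_normal_form_real n_gt0 hE _ pnf).
  exists (quadric_plus phi) => // m; apply/subr0_eq.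
  by rewrite quadric_skew real_phi subrr.
- have [_ _ eq0] := pnf0; exists (quadric_plus phi0) => // m; apply/subr0_eq.
  by rewrite quadric_skew (all_real _ pnf0) subrr.
Qed.
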